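(* Let $\alpha\in\mathbb{N}_0+\frac12$ and $\mathbf m=(m_1,\dots,m_n)\in\mathbb{N}_0^n$ with $m_1,\dots,m_n$ pairwise distinct, and $(t_{m_1},\dots,t_{m_n})\in\mathbb{R}^n$. Then $\tau^{(\alpha)}_{\mathbf m}(z)$ has no zeros on $[-1,1]$ if and only if $t_{m_j}>-(\nu^{(\alpha)}_{m_j})^{-1}$ for all $j=1,\dots,n$. If these conditions hold, then $\{C^{(\alpha)}_{\mathbf m;i}\}_{i\in\mathbb{N}_0}$ is a family of exceptional Gegenbauer polynomials with weight $W^{(\alpha)}_{\tau^{(\alpha)}_{\mathbf m}}(z)=(1-z^2)^{\alpha-1/2}\tau^{(\alpha)}_{\mathbf m}(z)^{-2}$, and $$\int_{-1}^1\left(C^{(\alpha)}_{\mathbf m;i}(u)\right)^2W^{(\alpha)}_{\tau^{(\alpha)}_{\mathbf m}}(u)\,du=\frac{\nu^{(\alpha)}_i}{1+\delta_{i,\mathbf m}t_i\nu^{(\alpha)}_i},\qquad i\in\mathbb{N}_0,$$ where $\delta_{i,\mathbf m}=1$ if $i\in\{m_1,\dots,m_n\}$ and $0$ otherwise.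
   Context: $\nu^{(\alpha)}_i=\dfrac{\pi\,2^{1-2\alpha}\Gamma(i+2\alpha)}{i!\,(i+\alpha)\Gamma(\alpha)^2}$. For a nonzero polynomial $\tau$, $T^{(\alpha)}_\tau=(1-z^2)\left(D_z^2-2\frac{\tau_z}{\tau}D_z+\frac{\tau_{zz}}{\tau}\right)-(2\alpha+1)zD_z+(2\alpha-1)z\frac{\tau_z}{\tau}$ and $W^{(\alpha)}_\tau=(1-z^2)^{\alpha-1/2}\tau^{-2}$. $T^{(\alpha)}_\tau$ is an exceptional Gegenbauer operator if it has polynomial eigenfunctions $\{\pi_i\}_{i\in\mathbb{N}_0}$ of pairwise distinct degrees with only finitely many nonnegative integers missing from $\{\deg\pi_i\}$. $\{\pi_i\}$ is a family of exceptional Gegenbauer polynomials with weight $W^{(\alpha)}_\tau$ if (a) $\tau$ has no zeros on $I=[-1,1]$; (b) the $\pi_i$ are the eigenpolynomials of an exceptional Gegenbauer operator $T^{(\alpha)}_\tau$; (c) $\{\pi_i\}$ is complete in $L^2(I,W^{(\alpha)}_\tau(z)dz)$. $C^{(\alpha)}_i(z)=\sum_{k=0}^{\lfloor i/2\rfloor}(-1)^k\frac{\Gamma(i-k+\alpha)}{\Gamma(\alpha)k!(i-2k)!}(2z)^{i-2k}$; $W^{(\alpha)}(z)=(1-z^2)^{\alpha-1/2}$; $\rho^{(\alpha)}_{ij}(z)=\int_{-1}^zC^{(\alpha)}_iC^{(\alpha)}_jW^{(\alpha)}\,du$. $\mathcal R^{(\alpha)}_{\mathbf m}$ is the $n\times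 n$ matrix with entries $\delta_{k\ell}+t_{m_\ell}\rho^{(\alpha)}_{m_km_\ell}(z)$; $\tau^{(\alpha)}_{\mathbf m}=\det\mathcal R^{(\alpha)}_{\mathbf m}$; $\mathbf Q^{(\alpha)}_{\mathbf m}=\tau^{(\alpha)}_{\mathbf m}(\mathcal R^{(\alpha)}_{\mathbf m})^{-1}(C^{(\alpha)}_{m_1},\dots,C^{(\alpha)}_{m_n})^T$. $C^{(\alpha)}_{\mathbf m;i}$ is the $(n+1)$-st entry of $\mathbf Q^{(\alpha)}_{(m_1,\dots,m_n,i)}$ computed with parameters $(t_{m_1},\dots,t_{m_n},s)$, $s\in\mathbb{R}$ arbitrary (the entry does not depend on $s$). *)

(* Defs.v *)
From HB Require Import structures.
From mathcomp Require Import all_boot all_order all_algebra.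
From mathcomp Require Import all_classical all_reals all_analysis.
Set Implicit Arguments. Unset Strict Implicit. Unset Printing Implicit Defensive.
Import Order.TTheory GRing.Theory Num.Theory.
Import numFieldNormedType.Exports.
Local Open Scope classical_set_scope.
Local Open Scope ring_scope.

Section XGegen.
Variable R : realType.

Notation mu := (@lebesgue_measure R).

Definition alph (k : nat) : R := k%:R + 2^-1.

Definition Gamma (x : R) : R :=
  fine (\int[mu]_(t in `]0%R, +oo[) ((t `^ (x - 1)) * expR (- t))%:E)%E.

Definition nu (k i : nat) : R :=
  pi * (2 `^ (1 - 2 * alph k)) * Gamma (i%:R + 2 * alph k)
  / (i`!%:R * (i%:R + alph k) * Gamma (alph k) ^+ 2).

Definition gegen (k i : nat) : {poly R} :=
  \sum_(0 <= l < (i./2).+1)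
    ((-1) ^+ l * Gamma (i%:R - l%:R + alph k)
      / (Gamma (alph k) * l`!%:R * (i - 2 * l)`!%:R)) *: (2%:R *: 'X) ^+ (i - 2 * l).

(* W^(alpha)(z) = (1 - z^2)^(alpha - 1/2) = (1 - z^2)^k, as a polynomial *)
Definition Wpoly (k : nat) : {poly R} := (1 - 'X ^+ 2) ^+ k.

Definition antideriv (p : {poly R}) : {poly R} :=
  \poly_(j < (size p).+1) (if j is j'.+1 then p`_j' / j'.+1%:R else 0).

(* rho^(alpha)_{ij}(z) = int_{-1}^z C_i C_j W du  (a polynomial in z) *)
Definition rho (k i j : nat) : {poly R} :=
  let P := antideriv (gegen k i * gegen k j * Wpoly k) in P - (P.[-1])%:P.

(* the matrix R^(alpha)_m, with parameters tp given by position: tp l = t_{m_l} *)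
Definition Rmx (k n : nat) (m : 'I_n -> nat) (tp : 'I_n -> R) : 'M[{poly R}]_n :=
  \matrix_(a < n, b < n) ((a == b)%:R + tp b *: rho k (m a) (m b)).

Definition tau (k n : nat) (m : 'I_n -> nat) (tp : 'I_n -> R) : {poly R} :=
  \det (Rmx k m tp).

(* Q^(alpha)_m = tau R^(-1) (C_{m_1},...,C_{m_n})^T = adj(R) (C_{m_1},...)^T *)
Definition Qvec (k n : nat) (m : 'I_n -> nat) (tp : 'I_n -> R) : 'cV[{poly R}]_n :=
  \adj (Rmx k m tp) *m \col_(a < n) gegen k (m a).

Definition snoc (T : Type) (n : nat) (f : 'I_n -> T) (x : T) : 'I_n.+1 -> T :=
  fun j => if unlift ord_max j is Some j' then f j' else x.

Definition Cmi (k n : nat) (m : 'I_n -> nat) (tp : 'I_n -> R) (s : R) (i : nat)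
  : {poly R} :=
  Qvec k (snoc m i) (snoc tp s) ord_max ord0.

(* T^(alpha)_tau applied to a polynomial pi, evaluated at z (where tau(z) <> 0) *)
Definition Top (k : nat) (ta p : {poly R}) (z : R) : R :=
  (1 - z ^+ 2) * (p^`(2).[z] - 2 * ta^`().[z] / ta.[z] * p^`().[z]
                  + ta^`(2).[z] / ta.[z] * p.[z])
  - (2 * alph k + 1) * z * p^`().[z]
  + (2 * alph k - 1) * z * ta^`().[z] / ta.[z] * p.[z].

Definition exceptional_eigenfamily (k : nat) (ta : {poly R}) (p : nat -> {poly R})
  : Prop :=
  ta != 0 /\
  (forall i, p i != 0 /\
     exists lam : R, forall z : R, ta.[z] != 0 -> Top k ta (p i) z = lam * (p i).[z]) /\
  (forall i j, (size (p i)).-1 = (size (p j)).-1 -> i = j) /\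
  (exists N : nat, forall d : nat, (N <= d)%N -> exists i, (size (p i)).-1 = d).

Definition Wtau (k : nat) (ta : {poly R}) (z : R) : R :=
  (1 - z ^+ 2) ^+ k / ta.[z] ^+ 2.

Definition I11 : set R := `[(-1)%R, 1%R].

Definition complete_L2 (w : R -> R) (p : nat -> {poly R}) : Prop :=
  forall f : R -> R, measurable_fun I11 f ->
    (\int[mu]_(x in I11) ((f x ^+ 2 * w x)%:E) < +oo)%E ->
    forall eps : R, 0 < eps ->
      exists (N : nat) (c : nat -> R),
        (\int[mu]_(x in I11) (((f x - \sum_(i < N) c i * (p i).[x]) ^+ 2 * w x)%:E)
           < eps%:E)%E.

Definition XGegenbauer_family (k : nat) (ta : {poly R}) (p : nat -> {poly R}) : Prop :=
  (forall z, -1 <= z <= 1 -> ta.[z] != 0) /\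
  exceptional_eigenfamily k ta p /\
  complete_L2 (Wtau k ta) p.

Definition delta_t (n : nat) (m : 'I_n -> nat) (tp : 'I_n -> R) (i : nat) : R :=
  if [pick j | m j == i] is Some j then tp j else 0.

End XGegen.

(* Main.v *)
Require Import Defs.
From HB Require Import structures.
From mathcomp Require Import all_boot all_order all_algebra.
From mathcomp Require Import all_classical all_reals all_analysis.
From mathcomp Require Import perm measurable_realfun.
From mathcomp Require Import ring lra zify.
Set Implicit Arguments. Unset Strict Implicit. Unset Printing Implicit Defensive.
Import Order.TTheory GRing.Theory Num.Theory.
Import numFieldNormedType.Exports.
Local Open Scope classical_set_scope.
Local Open Scope ring_scope.

(* Adjoining one index c with parameter s to m is a confluent Darboux step: with
   F = 1 + s g_cc / tau, where g_ij / tau is the primitive of C_{m;i} C_{m;j} W / tau^2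
   vanishing at -1, one has tau' = tau F and
     C'_i = F C_i - (s g_ic / tau) C_c.
   Hence all statements follow by induction on n.  The eigenvalue equation, written
   in Hirota's bilinear form, is preserved by each step with the same eigenvalue
   -i(i + 2 alpha); comparing leading coefficients in it shows that the degree of C_{m;i} is
   deg tau + i or deg tau - i - 2 alpha, so the degrees are distinct and almost all
   occur.  F is monotone from 1 to 1 + s nu_c, which gives the condition for tau not
   to vanish, and the value of g_ii / tau at 1 gives the norms.  For completeness, the
   transformation C_i |-> C_{m;i} can be inverted explicitly on tau^2 R[z], so the
   C_{m;i} span a space containing tau^2 R[z], which is dense. *)

(** Because $\alpha-1/2=k$ is a natural number, the weight is a polynomial, and so are $\rho_{ij}$,
    $\tau$, $C_{m;i}$ and $g_{ij}$; the induction therefore stays inside a polynomial ring. It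
    closes only when all indices are carried together: the new eigenvalue equation for $i$ consumes
    the Wronskian relation $(\lambda_i-\lambda_c)g_{ic}\tau=(1-z^2)W(C_c\,DC_i-C_i\,DC_c)$, and the
    new Wronskian relation for $(i,j)$ consumes three old ones. Since $\tau(-1)=1$ for all real
    parameters, $\tau$ is never the zero polynomial, so these identities need no condition on the
    $t_j$; positivity enters only afterwards. In the converse about zeros, an index can be removed
    safely only if its parameter is negative, since $1/F$ is then nondecreasing from 1; such an
    index is permuted to the end, and if there is none the condition is trivial. The constants
    $\nu_i$ are never computed in closed form: norms and $\nu_i$ satisfy the same recursions in $i$
    and $k$, so only $\Gamma(x+1)=x\Gamma(x)$, $\Gamma(1)=1$ and $\Gamma(1/2)=\sqrt\pi$ are
    required. *)

(** * The Gamma function: functional equation and the values at 1 and 1/2 *)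

Section Gamma.
Variable R : realType.
Notation mu := (@lebesgue_measure R).

Lemma is_derive_continuous (F : R -> R) (x d : R) :
  is_derive x 1 F d -> F @ x --> F x.
Proof.
move=> dF; apply/differentiable_continuous/derivable1_diffP.
exact: ex_derive.
Qed.

Lemma FTC2_segment (f F : R -> R) (a b : R) : a < b ->
  (forall x, x \in `[a, b] -> is_derive x 1 F (f x)) ->
  (forall x, x \in `[a, b] -> {for x, continuous f}) ->
  (\int[mu]_(x in `[a, b]) (f x)%:E)%E = (F b - F a)%:E.
Proof.
move=> ab dF cf.
have cF x : x \in `[a, b] -> {for x, continuous F}.
  by move=> /dF; exact: is_derive_continuous.
have aI : a \in `[a, b] by rewrite in_itv/= lexx ltW.
have bI : b \in `[a, b] by rewrite in_itv/= lexx ltW.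
rewrite EFinB; apply: continuous_FTC2 => //.
- apply: continuous_in_subspaceT => x; rewrite inE/= => xI; exact: cf.
- split.
  + move=> x xI; apply: ex_derive; apply: dF.
    exact: subset_itv_oo_cc xI.
  + exact: cvg_at_right_filter (cF _ aI).
  + exact: cvg_at_left_filter (cF _ bI).
- move=> x xI; rewrite derive1E; apply: derive_val; apply: dF.
  exact: subset_itv_oo_cc xI.
Qed.

(* Compact intervals exhausting ]0, +oo[: the library's FTC and substitution
   lemmas need continuity up to the boundary, which the integrand of Gamma lacks at 0. *)
Definition exhaust (N : nat) : set R := `[N.+1%:R^-1, N.+1%:R].

Lemma bigcup_exhaust : \bigcup_N exhaust N = `]0, +oo[%classic.
Proof.
apply/seteqP; split => x /=.
  move=> [N _]; rewrite /exhaust /= !in_itv/= andbT => /andP[+ _].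
  by apply: lt_le_trans; rewrite invr_gt0.
rewrite in_itv/= andbT => x0.
exists (maxn (Num.truncn x) (Num.truncn x^-1)) => //.
rewrite /exhaust /= in_itv/=; apply/andP; split.
  rewrite -[leRHS]invrK lef_pV2 ?posrE ?invr_gt0//.
  apply: ltW; apply: lt_le_trans (truncnS_gt _) _.
  by rewrite ler_nat ltnS leq_maxr.
apply: ltW; apply: lt_le_trans (truncnS_gt _) _.
by rewrite ler_nat ltnS leq_maxl.
Qed.

Lemma cvg_integral_exhaust (f : R -> R) :
  (forall x, 0 < x -> 0 <= f x) -> {in `]0, +oo[, continuous f} ->
  (\int[mu]_(x in exhaust N) (f x)%:E @[N --> \oo] -->
    \int[mu]_(x in `]0%R, +oo[) (f x)%:E)%E.
Proof.
move=> f0 cf; rewrite -bigcup_exhaust.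
have pos N x : exhaust N x -> 0 < x.
  move=> Nx; have : (\bigcup_N exhaust N) x by exists N.
  by rewrite bigcup_exhaust /= in_itv/= andbT.
apply: ge0_nondecreasing_set_cvg_integral.
- apply/nondecreasing_seqP => N; apply/subsetPset => x.
  rewrite /exhaust /= !in_itv/= => /andP[h1 h2]; apply/andP; split.
    by apply: le_trans h1; rewrite lef_pV2 ?posrE// ler_nat.
  by apply: le_trans h2 _; rewrite ler_nat.
- by move=> N; exact: measurable_itv.
- move=> N; apply/measurable_EFinP.
  apply: subspace_continuous_measurable_fun; first exact: measurable_itv.
  apply: continuous_in_subspaceT => x; rewrite inE => /pos x0.
  by apply: cf; rewrite in_itv/= x0.
- by move=> N x /pos /f0; rewrite lee_fin.
Qed.


(** For an integer $n\ge x$, the bound $e^y\ge y^{n+2}/(n+2)!$ gives $y^xe^{-y}\le (n+2)!/y$ when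
    $y\ge 1$. *)
Lemma cvg_powR_expRN (x : R) :
  N.+1%:R `^ x * expR (- N.+1%:R) @[N --> \oo] --> (0 : R).
Proof.
have [n xn] : exists n : nat, x <= n%:R.
  by exists (Num.truncn x).+1; apply: ltW; exact: truncnS_gt.
apply: (@squeeze_cvgr _ _ _ _ (cst 0)
  (fun N : nat => n.+2`!%:R * (N.+1%:R)^-1)) => /=.
- apply: nearW => N; apply/andP; split.
    by rewrite mulr_ge0 ?powR_ge0 ?expR_ge0.
  have N1 : (1 : R) <= N.+1%:R by rewrite ler1n.
  have N0 : (0 : R) < N.+1%:R by rewrite ltr0n.
  apply: (@le_trans _ _ (N.+1%:R ^+ n * expR (- N.+1%:R))).
    by rewrite ler_wpM2r ?expR_ge0// -powR_mulrn ?ler0n// ler_powR.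
  rewrite expRN ler_pdivrMr ?expR_gt0//.
  have H := @expR_ge1Dxn R N.+1%:R n.+1 (ltW N0).
  have {}H : N.+1%:R ^+ n.+2 / n.+2`!%:R <= expR N.+1%:R :> R.
    by apply: le_trans H; rewrite lerDr.
  rewrite ler_pdivrMr ?ltr0n ?fact_gt0// in H.
  rewrite mulrAC ler_pdivlMr// mulrC [leRHS]mulrC.
  apply: le_trans H.
  by rewrite -exprS ler_weXn2l // ltnW.
- exact: cvg_cst.
- rewrite -[X in _ --> X](mulr0 (n.+2`!%:R)).
  by apply: cvgM; [exact: cvg_cst|exact: cvg_harmonic].
Qed.

Definition gammaf (x t : R) : R := t `^ (x - 1) * expR (- t).

Lemma gammaf_ge0 x t : 0 <= gammaf x t.
Proof. by rewrite mulr_ge0 ?powR_ge0 ?expR_ge0. Qed.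

Lemma gammaf_continuous x : {in `]0, +oo[, continuous (gammaf x)}.
Proof.
move=> t; rewrite in_itv/= andbT => t0.
apply: cvgM.
  exact: (is_derive_continuous (is_derive1_powR (x - 1) t0)).
apply: continuous_comp; first exact: (@continuousN _ _ _ id).
exact: continuous_expR.
Qed.

Definition Gammae (x : R) : \bar R :=
  (\int[mu]_(t in `]0%R, +oo[) (gammaf x t)%:E)%E.

Lemma GammaE x : Gamma x = fine (Gammae x). Proof. by []. Qed.

Lemma exhaust_gt0 N t : exhaust N t -> 0 < t.
Proof.
by rewrite /exhaust /= in_itv/= => /andP[+ _]; apply: lt_le_trans; rewrite invr_gt0.
Qed.

(** Integration by parts on the exhausting intervals: $-t^xe^{-t}$ is a primitive of
    [gammaf (x + 1) t - x * gammaf x t], and its boundary values tend to 0. In the extended reals no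
    finiteness has to be known beforehand. *)
Lemma Gammae_succ x : 0 < x -> Gammae (x + 1) = (x%:E * Gammae x)%E.
Proof.
move=> x0.
have c1 := cvg_integral_exhaust (fun t _ => gammaf_ge0 (x + 1) t) (@gammaf_continuous (x + 1)).
have c0 := cvg_integral_exhaust (fun t _ => gammaf_ge0 x t) (@gammaf_continuous x).
pose F t : R := t `^ x * expR (- t).
(* The index starts at [N.+1] because [exhaust 0] is the single point 1, while [FTC2_segment] needs
   a nondegenerate interval. *)
have E N : (\int[mu]_(t in exhaust N.+1) (gammaf (x + 1) t)%:E =
    x%:E * \int[mu]_(t in exhaust N.+1) (gammaf x t)%:E
    + (F N.+2%:R^-1 - F N.+2%:R)%:E)%E.
  have N2 : N.+2%:R^-1 < N.+2%:R :> R.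
    apply: (@lt_trans _ _ 1); first by rewrite invf_lt1 ?ltr1n.
    by rewrite ltr1n.
  have gI u : integrable mu (exhaust N.+1) (EFin \o gammaf u).
    apply: continuous_compact_integrable; first exact: segment_compact.
    apply: continuous_in_subspaceT => t; rewrite inE => /exhaust_gt0 t0.
    by apply: gammaf_continuous; rewrite in_itv/= t0.
  have H : (\int[mu]_(t in exhaust N.+1) (gammaf (x + 1) t - x * gammaf x t)%:E
      = (F N.+2%:R^-1 - F N.+2%:R)%:E)%E.
    transitivity (- F N.+2%:R - - F N.+2%:R^-1)%:E; last by congr EFin; ring.
    apply: (@FTC2_segment _ (fun t => - F t) _ _ N2) => t tI;
      have t0 : 0 < t by apply: (@exhaust_gt0 N.+1).
      have dp := is_derive1_powR x t0.
      apply: is_derive_eq.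
      rewrite /gammaf addrK /GRing.scale/=; ring.
    have tt : t \in `]0, +oo[ by rewrite in_itv/= t0.
    apply: cvgB; first exact: gammaf_continuous.
    by apply: cvgM; [exact: cvg_cst|exact: gammaf_continuous].
  rewrite -H.
  have -> : (\int[mu]_(t in exhaust N.+1) (gammaf (x + 1) t - x * gammaf x t)%:E =
    \int[mu]_(t in exhaust N.+1) ((EFin \o gammaf (x + 1)%R) t - x%:E * (EFin \o gammaf x) t))%E.
    by apply: eq_integral => t _; rewrite EFinB EFinM.
  rewrite (integralB _ (gI (x + 1)) (integrableZl _ x (gI x))); do ?exact: measurable_itv.
  rewrite (integralZl _ (gI x)); do ?exact: measurable_itv.
  rewrite [RHS]addeC subeK //; apply: fin_numM => //.
  by apply: integrable_fin_num; [exact: measurable_itv|exact: gI].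
have cF : (F N.+2%:R^-1 - F N.+2%:R) @[N --> \oo] --> (0 : R).
  rewrite -[X in _ --> X](subr0 0); apply: cvgB; last first.
    by have := cvg_powR_expRN x; rewrite -cvg_shiftS.
  rewrite -[X in _ --> X](mul0r 1); apply: cvgM.
    have /cvg_at_rightP := powR_cvg0 x0.
    move=> /(_ (fun N => N.+2%:R^-1)) /=; apply; split.
      by move=> N; rewrite invr_gt0.
    by have := @cvg_harmonic R; rewrite -cvg_shiftS.
  have -> : nbhs (1 : R) = nbhs (expR (- 0) : R) by rewrite oppr0 expR0.
  apply: continuous_cvg; first exact: continuous_expR.
  apply: cvgN.
  by have := @cvg_harmonic R; rewrite -cvg_shiftS.
have c1' := c1; rewrite -cvg_shiftS in c1'.
have c2 : ((x%:E * \int[mu]_(t in exhaust N.+1) (gammaf x t)%:E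
    + (F N.+2%:R^-1 - F N.+2%:R)%:E) @[N --> \oo] --> x%:E * Gammae x + 0)%E.
  apply: cvgeD.
  - by rewrite fin_num_adde_defl.
  - apply: cvgeZl => //.
    by have := c0; rewrite -cvg_shiftS.
  - by apply: cvg_EFin; [exact: nearW|exact: cF].
rewrite adde0 in c2.
have -> : Gammae (x + 1) = limn (fun N => \int[mu]_(t in exhaust N.+1) (gammaf (x + 1) t)%:E)%E.
  by apply/esym/cvg_lim.
apply/cvg_lim => //.
by under eq_cvg do rewrite E.
Qed.


Lemma Gammae1 : Gammae 1 = 1%E.
Proof.
have c0 := cvg_integral_exhaust (fun t _ => gammaf_ge0 1 t) (@gammaf_continuous 1).
have E N : (\int[mu]_(t in exhaust N.+1) (gammaf 1 t)%:E =
    (expR (- N.+2%:R^-1) - expR (- N.+2%:R))%:E)%E.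
  have N2 : N.+2%:R^-1 < N.+2%:R :> R.
    apply: (@lt_trans _ _ 1); first by rewrite invf_lt1 ?ltr1n.
    by rewrite ltr1n.
  transitivity (- expR (- N.+2%:R : R) - - expR (- N.+2%:R^-1 : R))%:E;
    last by congr EFin; ring.
  apply: (@FTC2_segment _ (fun t => - expR (- t)) _ _ N2) => t tI;
    have t0 : 0 < t by apply: (@exhaust_gt0 N.+1).
    apply: is_derive_eq.
    by rewrite /gammaf subrr powRr0 /GRing.scale/=; ring.
  by apply: gammaf_continuous; rewrite in_itv/= t0.
have h : (\int[mu]_(t in exhaust N.+1) (gammaf 1 t)%:E @[N --> \oo] --> (1 : R)%:E)%E.
  under eq_cvg do rewrite E.
  apply: cvg_EFin; first exact: nearW.
  rewrite -[X in _ --> X](subr0 1); apply: cvgB; last first.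
    have := @cvgn_expR R.
    rewrite -(cvg_shiftn 2) /=.
    by under eq_cvg do rewrite addn2.
  have -> : nbhs (1 : R) = nbhs (expR (- 0) : R) by rewrite oppr0 expR0.
  apply: continuous_cvg; first exact: continuous_expR.
  apply: cvgN.
  by have := @cvg_harmonic R; rewrite -cvg_shiftS.
apply: (cvg_unique _ _ h) => //.
by rewrite -cvg_shiftS in c0.
Qed.

(** The substitution $t=u^2$ turns the integral into twice the Gauss integral over the half line. *)
Lemma Gammae_half : Gammae 2^-1 = (Num.sqrt pi)%:E.
Proof.
have c0 := cvg_integral_exhaust (fun t _ => gammaf_ge0 2^-1 t) (@gammaf_continuous 2^-1).
have cg := @cvg_integral_exhaust gauss_fun (fun t _ => gauss_fun_ge0 t)
  (fun t _ => @continuous_gauss_fun R t).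
have E N : (\int[mu]_(t in `[(N.+2%:R^-1 ^+ 2)%R, (N.+2%:R ^+ 2)%R]) (gammaf 2^-1 t)%:E =
    2%:E * \int[mu]_(t in exhaust N.+1) (gauss_fun t)%:E)%E.
  have N2 : N.+2%:R^-1 < N.+2%:R :> R.
    apply: (@lt_trans _ _ 1); first by rewrite invf_lt1 ?ltr1n.
    by rewrite ltr1n.
  have N0 : (0 : R) < N.+2%:R^-1 by rewrite invr_gt0.
  have d2 : ((fun t : R => t ^+ 2)^`())%classic = (fun t => 2 * t).
    apply/funext => t; rewrite derive1E; apply: derive_val.
    apply: is_derive_eq; rewrite /GRing.scale/=; ring.
  have c2 : continuous (fun t : R => 2 * t).
    by move=> t; apply: cvgM; [exact: cvg_cst|exact: cvg_id].
  have cs : continuous (fun t : R => t ^+ 2).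
    by move=> t; exact: exprn_continuous.
  rewrite (@integration_by_substitution_increasing _ (fun t : R => t ^+ 2)).
  - have gI : integrable mu (exhaust N.+1) (EFin \o gauss_fun).
      apply: continuous_compact_integrable; first exact: segment_compact.
      by apply: continuous_subspaceT; exact: continuous_gauss_fun.
      rewrite -(integralZl _ gI); do ?exact: measurable_itv.
    apply: eq_integral => t /set_mem /exhaust_gt0 t0; rewrite -EFinM d2; congr EFin.
    rewrite !fctE /= /gammaf /gauss_fun.
    have -> : 2^-1 - 1 = - 2^-1 :> R by lra.
    rewrite powRN powR12_sqrt ?sqr_ge0// sqrtr_sqr gtr0_norm//.
    by field; rewrite gt_eqF.
  - exact: ltW.
  - move=> x y /exhaust_gt0 x0 /exhaust_gt0 y0 xy.
    by rewrite ltrXn2r// ltW.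
  - by move=> t _; rewrite d2; exact: c2.
  - by rewrite d2; apply/cvg_ex; exists (2 * N.+2%:R^-1); apply: cvg_at_right_filter; exact: c2.
  - by rewrite d2; apply/cvg_ex; exists (2 * N.+2%:R); apply: cvg_at_left_filter; exact: c2.
  - split; last 2 first.
    + by apply: cvg_at_right_filter; exact: cs.
    + by apply: cvg_at_left_filter; exact: cs.
    + by move=> t _; exact: exprn_derivable.
  - apply: continuous_in_subspaceT => t; rewrite inE /= in_itv/= => /andP[t1 _].
    apply: gammaf_continuous; rewrite in_itv/= andbT.
    by apply: lt_le_trans t1; rewrite exprn_gt0.
have H1 : (\int[mu]_(t in `[(N.+2%:R^-1 ^+ 2)%R, (N.+2%:R ^+ 2)%R]) (gammaf 2^-1 t)%:E @[N --> \oo]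
   --> Gammae 2^-1)%E.
  (* The squared intervals form a subsequence of [exhaust], namely the indices $(N+2)^2-1$. *)
  have -> : (fun N : nat => \int[mu]_(t in `[(N.+2%:R^-1 ^+ 2)%R, (N.+2%:R ^+ 2)%R]) (gammaf 2^-1 t)%:E)%E
    = (fun N : nat => \int[mu]_(t in exhaust N) (gammaf 2^-1 t)%:E)%E \o (fun N => (N.+2 ^ 2).-1)%N.
    apply/funext => N; rewrite /exhaust [RHS]/comp.
    by rewrite prednK ?expn_gt0// natrX exprVn.
  apply: cvg_comp c0.
  apply/cvgnyPge => M; near=> N.
  have : (M <= N)%N by near: N; exact: nbhs_infty_ge.
  move=> MN; rewrite -ltnS prednK ?expn_gt0//.
  nia.
have sE : (Num.sqrt pi)%:E = (2%:E * (Num.sqrt pi / 2)%:E)%E :> \bar R.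
  by rewrite -EFinM; congr EFin; field.
rewrite (funext E) in H1.
rewrite sE; apply: (cvg_unique _ H1) => //.
apply: cvgeZl => //.
rewrite -integral0y_gauss -integral_itv_obnd_cbnd; last first.
  apply/measurable_EFinP; apply: measurable_funTS; exact: measurable_gauss_fun.
by rewrite -cvg_shiftS in cg.
Unshelve. all: end_near. Qed.

Lemma GammaS (x : R) : 0 < x -> Gamma (x + 1) = x * Gamma x :> R.
Proof.
move=> x0; rewrite !GammaE Gammae_succ//.
have : (0 <= Gammae x)%E.
  by apply: integral_ge0 => t _; rewrite lee_fin gammaf_ge0.
(* Were the integral infinite, [fine] would send both sides to 0, so the equation holds in that case
   too. *)
case: (Gammae x) => [r|//|//] _ //=.
by rewrite gt0_muley ?lte_fin//= mulr0.
Qed.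

Lemma Gamma_nat n : Gamma n.+1%:R = n`!%:R :> R.
Proof.
elim: n => [|n IH]; first by rewrite GammaE Gammae1.
by rewrite -natr1 GammaS ?ltr0n// IH factS natrM.
Qed.

Lemma Gamma_half_sqr : Gamma (2^-1 : R) ^+ 2 = pi.
Proof. by rewrite GammaE Gammae_half sqr_sqrtr ?pi_ge0. Qed.

Lemma Gamma_half_gt0 : 0 < Gamma (2^-1 : R).
Proof. by rewrite GammaE Gammae_half sqrtr_gt0 pi_gt0. Qed.

Lemma Gamma_alph_gt0 k : 0 < Gamma (alph R k).
Proof.
elim: k => [|k IH]; first by rewrite /alph add0r Gamma_half_gt0.
have a0 : 0 < alph R k by rewrite /alph ltr_wpDl ?ler0n ?invr_gt0.
have -> : alph R k.+1 = alph R k + 1 by rewrite /alph -natr1; ring.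
by rewrite GammaS// mulr_gt0.
Qed.

End Gamma.

(** * Primitives of polynomials vanishing at -1 *)

Section Primitive.
Variable R : realType.
Implicit Types p q : {poly R}.

Lemma deriv_antideriv p : (antideriv p)^`() = p.
Proof.
apply/polyP => i; rewrite coef_deriv coef_poly /= ltnS.
case: ltnP => [_|h]; last by rewrite mul0rn nth_default.
by rewrite -[LHS]mulr_natr mulfVK// pnatr_eq0.
Qed.

Definition prim p := antideriv p - ((antideriv p).[-1])%:P.

Lemma deriv_prim p : (prim p)^`() = p.
Proof. by rewrite derivB derivC subr0 deriv_antideriv. Qed.

Lemma prim_N1 p : (prim p).[-1] = 0.
Proof. by rewrite hornerD hornerN hornerC subrr. Qed.

Lemma deriv_eq0 p : p^`() = 0 -> p = (p.[-1])%:P.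
Proof.
move=> h; have [c pc] : exists c, p = c%:P.
  exists (p`_0); apply/polyP => -[|i]; rewrite coefC//=.
  have := congr1 (fun q : {poly R} => q`_i) h; rewrite coef_deriv coef0 => /eqP.
  by rewrite mulrn_eq0 /= => /eqP.
by rewrite pc hornerC.
Qed.

Lemma deriv_inj_N1 p q : p^`() = q^`() -> p.[-1] = q.[-1] -> p = q.
Proof.
move=> h1 h2; apply/eqP; rewrite -subr_eq0; apply/eqP.
have /deriv_eq0 -> : (p - q)^`() = 0 by rewrite derivB h1 subrr.
by rewrite hornerD hornerN h2 subrr.
Qed.

(** The way to every identity about [prim] and [rho]: exhibit a candidate, differentiate it, and
    check its value at -1. *)
Lemma primE p q : q^`() = p -> q.[-1] = 0 -> prim p = q.
Proof. by move=> h1 h2; apply: deriv_inj_N1; rewrite ?deriv_prim ?prim_N1. Qed.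

Lemma primD p q : prim (p + q) = prim p + prim q.
Proof.
apply: primE; first by rewrite derivD !deriv_prim.
by rewrite [LHS]hornerD !prim_N1 addr0.
Qed.

Lemma primZ c p : prim (c *: p) = c *: prim p.
Proof. by apply: primE; rewrite ?derivZ ?deriv_prim// hornerZ !prim_N1 mulr0. Qed.

Lemma rhoE k i j : rho R k i j = prim (gegen R k i * gegen R k j * Wpoly R k).
Proof. by []. Qed.

(** The integral over $[-1,1]$, taken algebraically so that orthogonality and norms need no measure
    theory. *)
Definition Intg p : R := (prim p).[1].

Lemma IntgD p q : Intg (p + q) = Intg p + Intg q.
Proof. by rewrite /Intg primD hornerD. Qed.

Lemma IntgZ c p : Intg (c *: p) = c * Intg p.
Proof. by rewrite /Intg primZ hornerZ. Qed.

Lemma Intg_deriv p : Intg p^`() = p.[1] - p.[-1].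
Proof.
rewrite /Intg (@primE _ (p - (p.[-1])%:P)) ?derivB ?derivC ?subr0 //;
by rewrite hornerD hornerN hornerC // subrr.
Qed.

End Primitive.

(** * Classical Gegenbauer polynomials: differential equation, recurrence, orthogonality *)

Section Gegenbauer.
Variables (R : realType) (k : nat).
Notation al := (alph R k).
Notation C := (gegen R k).
Notation W := (Wpoly R k).
Notation w := (Wpoly R k.+1).

Lemma alph_gt0 : 0 < al.
Proof. by rewrite /alph ltr_wpDl ?ler0n ?invr_gt0. Qed.

Definition poch n : R := \prod_(s < n) (al + s%:R).

Lemma pochS n : poch n.+1 = poch n * (al + n%:R).
Proof. by rewrite /poch big_ord_recr. Qed.

Lemma poch_gt0 n : 0 < poch n.
Proof. by apply: prodr_gt0 => i _; rewrite ltr_wpDr ?ler0n ?alph_gt0. Qed.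

Lemma Gamma_poch n : Gamma (n%:R + al) = Gamma al * poch n.
Proof.
elim: n => [|n IH]; first by rewrite add0r /poch big_ord0 mulr1.
have -> : n.+1%:R + al = n%:R + al + 1 by rewrite -natr1; ring.
rewrite GammaS; last by rewrite ltr_wpDl ?ler0n ?alph_gt0.
rewrite IH pochS; ring.
Qed.

(** The coefficient of $z^j$ in $C_{j+2l}$. With $(l,j)$ as coordinates there is no halving and no
    truncated subtraction, and neighbouring coefficients have rational ratios. *)
Definition gcoef l j : R := (-1) ^+ l * poch (l + j) * 2 ^+ j / (l`!%:R * j`!%:R).

Lemma gegen_coef i j : (C i)`_j =
  if (j <= i)%N && ~~ odd (i - j) then gcoef (i - j)./2 j else 0.
Proof.
rewrite /gegen coef_sum.
have E l : (l <= i./2)%N ->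
  (((-1) ^+ l * Gamma (i%:R - l%:R + alph R k) /
    (Gamma (alph R k) * l`!%:R * (i - 2 * l)`!%:R))
     *: (2%:R *: 'X) ^+ (i - 2 * l) : {poly R})`_j
  = if (j == i - 2 * l)%N then gcoef l j else 0.
  move=> li; rewrite exprZn !coefZ coefXn; case: eqP => [->|_]; last by rewrite !mulr0.
  have il : (l <= i)%N by lia.
  rewrite mulr1 -natrB// Gamma_poch /gcoef.
  have -> : (l + (i - 2 * l) = i - l)%N by lia.
  have g0 : Gamma al != 0 by rewrite gt_eqF// Gamma_alph_gt0.
  field; rewrite g0 !pnatr_eq0 -!lt0n !fact_gt0 //.
rewrite big_nat_cond (eq_bigr (fun l => if (j == i - 2 * l)%N then gcoef l j else 0)); last first.
  by move=> l /andP[/andP[_ li] _]; apply: E.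
rewrite -big_nat_cond -big_mkcond.
case: ifPn => [/andP[ji od]|h].
  rewrite big_mkord (bigD1 (Ordinal (_ : ((i - j)./2 < (i./2).+1)%N)))/=; first lia; last by lia.
  move=> H; rewrite big1 ?addr0// => l /andP[/eqP jl /eqP ne].
  by exfalso; apply: ne; apply: val_inj => /=; have := ltn_ord l; lia.
rewrite big_nat_cond big1// => l /andP[/andP[_ li] /eqP jl].
exfalso; move/negP: h; apply; rewrite jl.
have -> : (i - (i - 2 * l) = 2 * l)%N by lia.
by rewrite leq_subr mul2n odd_double.
Qed.

Lemma gegen_coefE l j : (C (j + 2 * l))`_j = gcoef l j.
Proof.
rewrite gegen_coef leq_addr addKn mul2n odd_double /=.
by rewrite doubleK.
Qed.

Lemma gegen_coef0 i j : (forall l, i != j + 2 * l)%N -> (C i)`_j = 0.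
Proof.
move=> h; rewrite gegen_coef; case: ifPn => // /andP[ji od].
by have := h ((i - j)./2); rewrite mul2n halfK (negbTE od) subn0 subnKC// eqxx.
Qed.

Lemma gegen_coef_lt i j : (i < j)%N -> (C i)`_j = 0.
Proof. by move=> ij; apply: gegen_coef0 => l; apply/eqP; lia. Qed.

Lemma gegen_lead i : (C i)`_i != 0.
Proof.
have := gegen_coefE 0 i; rewrite addn0 => ->; rewrite /gcoef mul1r gt_eqF//.
by rewrite divr_gt0 ?mulr_gt0 ?poch_gt0 ?exprn_gt0 ?ltr0n ?fact_gt0.
Qed.

Lemma gcoefSl l j : gcoef l.+1 j = - gcoef l j * (al + (l + j)%:R) / l.+1%:R.
Proof.
rewrite /gcoef addSn pochS exprS factS natrM; field.
have l0 := ler0n R l.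
by rewrite !pnatr_eq0 -!lt0n !fact_gt0 !andbT gt_eqF//; lra.
Qed.

Lemma gcoefSr l j : gcoef l j.+1 = gcoef l j * (al + (l + j)%:R) * 2 / j.+1%:R.
Proof.
rewrite /gcoef addnS pochS exprS factS natrM; field.
have j0 := ler0n R j.
by rewrite !pnatr_eq0 -!lt0n !fact_gt0 !andbT gt_eqF//; lra.
Qed.

Definition lam (i : nat) : R := - (i%:R * (i%:R + 2 * al)).

(** Coefficients of $z^j$ are compared. They all vanish unless $i=j+2l$; in that case [gcoefSr]
    twice and [gcoefSl] once reduce the claim to a rational identity. For $l=0$ only the leading
    coefficient is left. *)
Lemma gegen_ode i :
  (1 - 'X ^+ 2) * (C i)^`(2) - (2 * al + 1) *: ('X * (C i)^`()) = lam i *: C i.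
Proof.
apply/polyP => j.
have -> : ((1 - 'X ^+ 2) * (C i)^`(2) - (2 * al + 1) *: ('X * (C i)^`()))`_j
  = (j.+2%:R * j.+1%:R) * (C i)`_j.+2 - (j%:R * (j%:R - 1) + (2 * al + 1) * j%:R) * (C i)`_j.
  rewrite mulrBl mul1r coefB coefB coefZ coefXM coefXnM !derivnS derivn0 !coef_deriv.
  case: j => [|[|j]] /=; rewrite ?subn2 /= ?coef_deriv; ring.
rewrite coefZ.
have [[l ->]|h] := pselect (exists l, i = j + 2 * l)%N; last first.
  rewrite !gegen_coef0 ?mulr0 ?subr0//.
    by move=> l; apply/eqP => E; apply: h; exists l.
  by move=> l; apply/eqP => E; apply: h; exists l.+1; lia.
rewrite gegen_coefE /lam; case: l => [|l].
  rewrite gegen_coef_lt ?muln0 ?addn0 ?leqnn //; ring.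
have -> : (j + 2 * l.+1 = j.+2 + 2 * l)%N by lia.
have e : (j.+2 + 2 * l)%:R = j%:R + 2 + 2 * l%:R :> R by rewrite natrD natrM -addn2 natrD.
rewrite gegen_coefE gcoefSr gcoefSr gcoefSl e ![(l + _)%N%:R]natrD; field.
have := ler0n R j; have := ler0n R l => l0 j0.
by rewrite !gt_eqF//; lra.
Qed.

(** This three-term recurrence supplies the ratio of consecutive norms in [rho_diag_succ]; it is
    shifted by 2 to avoid truncated predecessors. *)
Lemma gegen_rec i : i.+2%:R *: C i.+2 =
  (2 * (i.+1%:R + al)) *: ('X * C i.+1) - (i%:R + 2 * al) *: C i.
Proof.
apply/polyP => j; rewrite coefB !coefZ coefXM.
have [[l E]|h] := pselect (exists l, i.+2 = j + 2 * l)%N; last first.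
  rewrite [(C i.+2)`_j]gegen_coef0; last first.
    by move=> l; apply/eqP => E; apply: h; exists l.
  rewrite [(C i)`_j]gegen_coef0; last first.
    by move=> l; apply/eqP => E; apply: h; exists l.+1; lia.
  case: j h => [|j] h /=; first by ring.
  rewrite [(C i.+1)`_j]gegen_coef0; last first.
    by move=> l; apply/eqP => E; apply: h; exists l; lia.
  ring.
case: l E => [|l] E.
  rewrite [(C i)`_j]gegen_coef_lt; last by lia.
  have -> : j = i.+2 by lia.
  have := gegen_coefE 0 i.+2; rewrite addn0 => -> /=.
  have := gegen_coefE 0 i.+1; rewrite addn0 => ->.
  rewrite gcoefSr add0n; field.
  have := ler0n R i => i0.
  by rewrite !gt_eqF//; lra.
have Ei : i = (j + 2 * l)%N by lia.
rewrite E gegen_coefE Ei gegen_coefE.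
case: j E Ei => [|j] E Ei /=.
  rewrite gcoefSl !natrD natrM -!natr1; field.
  have := ler0n R l => l0.
  by rewrite !gt_eqF//; lra.
have -> : (j.+1 + 2 * l).+1 = (j + 2 * l.+1)%N by lia.
rewrite gegen_coefE !gcoefSr gcoefSl !natrD !natrM -!natr1; field.
have := ler0n R j; have := ler0n R l => l0 j0.
by rewrite !gt_eqF//; lra.
Qed.

Lemma gegen0 : C 0 = 1.
Proof.
apply/polyP => -[|j]; rewrite coef1; last by rewrite gegen_coef_lt.
by have := gegen_coefE 0 0; rewrite addn0 => ->; rewrite /gcoef /poch big_ord0 !fact0 !expr0 !mulr1 invr1 mulr1.
Qed.

Lemma gegen1 : C 1 = (2 * al) *: ('X * C 0).
Proof.
apply/polyP => -[|[|j]]; rewrite coefZ coefXM /=.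
- by rewrite gegen_coef0 ?mulr0// => l; apply/eqP; lia.
- have := gegen_coefE 0 0; rewrite addn0 => ->.
  have := gegen_coefE 0 1; rewrite addn0 => ->.
  by rewrite gcoefSr addn0; field.
- by rewrite !gegen_coef_lt// mulr0.
Qed.

(** This puts the Gegenbauer operator into the self-adjoint form $W^{-1}D\,w\,D$. Unlike $W$, the
    polynomial $w=(1-z^2)W$ vanishes at both endpoints even for $k=0$. *)
Lemma deriv_w : w^`() = - (2 * al + 1) *: ('X * W) :> {poly R}.
Proof.
rewrite /Wpoly deriv_exp derivB derivXn -polyC1 derivC /= /alph.
have -> : - (2 * (k%:R + 2^-1) + 1) = - (k.+1%:R * 2%:R) :> R by rewrite -natr1; field.
rewrite -mul_polyC polyCN polyCM !polyC_natr polyC1; ring.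
Qed.

Lemma w_N1 : w.[-1] = 0.
Proof. by rewrite /Wpoly horner_exp !hornerE sqrrN expr1n subrr expr0n. Qed.

Lemma w_1 : w.[1] = 0.
Proof. by rewrite /Wpoly horner_exp !hornerE expr1n subrr expr0n. Qed.

Lemma wE : w = (1 - 'X ^+ 2) * W.
Proof. by rewrite /Wpoly exprS. Qed.

(** Lagrange's identity for the self-adjoint form. At $z=1$ the right side vanishes with $w$, which
    is orthogonality. *)
Lemma rho_wronskian i j :
  (lam i - lam j) *: rho R k i j = w * ((C i)^`() * C j - C i * (C j)^`()).
Proof.
rewrite rhoE -primZ; apply: primE; last by rewrite hornerM w_N1 mul0r.
have ei := gegen_ode i; have ej := gegen_ode j.
rewrite !derivnS !derivn0 in ei ej.
transitivity ((lam i *: C i) * C j * W - C i * (lam j *: C j) * W); last first.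
  by rewrite -!mul_polyC polyCB; ring.
rewrite -ei -ej derivM derivB !derivM deriv_w wE -!mul_polyC polyCN; ring.
Qed.

Lemma lam_inj i j : lam i = lam j -> i = j.
Proof.
move=> h; have a0 := alph_gt0; have i0 := ler0n R i; have j0 := ler0n R j.
have : (i%:R - j%:R) * (i%:R + j%:R + 2 * al) = 0 :> R.
  by apply/eqP; rewrite -subr_eq0; apply/eqP; move: h; rewrite /lam => h;
    rewrite subr0; lra.
move/eqP; rewrite mulf_eq0 => /orP[|/eqP h2]; last by exfalso; lra.
by rewrite subr_eq0 eqr_nat => /eqP.
Qed.

Lemma rho_sym i j : rho R k i j = rho R k j i.
Proof. by rewrite !rhoE [gegen R k i * _]mulrC. Qed.

Lemma rho_N1 i j : (rho R k i j).[-1] = 0.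
Proof. by rewrite rhoE prim_N1. Qed.

Lemma deriv_rho i j : (rho R k i j)^`() = C i * C j * W.
Proof. by rewrite rhoE deriv_prim. Qed.

Lemma rho_1_neq i j : i != j -> (rho R k i j).[1] = 0.
Proof.
move=> ij; have := congr1 (fun p : {poly R} => p.[1]) (rho_wronskian i j).
rewrite hornerZ hornerM w_1 mul0r => /eqP; rewrite mulf_eq0 subr_eq0 => /orP[/eqP/lam_inj E|/eqP//].
by rewrite E eqxx in ij.
Qed.

Lemma IntgCC i j : Intg (C i * C j * W) = (rho R k i j).[1].
Proof. by []. Qed.

Let h i := (rho R k i i).[1].

(** The mixed moment $x_j=\int zC_jC_{j+1}W$ links the norms: the recurrence times $C_j$ expresses
    $x_j$ by $h_j$, and times $C_{j+2}$ expresses $h_{j+2}$ by $x_{j+1}$. Orthogonality removes the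
    remaining term each time. *)
Lemma rho_diag_succ i : h i.+1 =
  (i%:R + al) * (i%:R + 2 * al) / (i.+1%:R * (i.+1%:R + al)) * h i.
Proof.
have a0 := alph_gt0; have i0 := ler0n R i.
pose x i := Intg ('X * C i * C i.+1 * W).
have X1 j : 2 * (j.+1%:R + al) * x j = (j%:R + 2 * al) * h j.
  have E : j.+2%:R *: (C j.+2 * C j * W) + (j%:R + 2 * al) *: (C j * C j * W) =
      (2 * (j.+1%:R + al)) *: ('X * C j * C j.+1 * W).
    have R0 := gegen_rec j; rewrite -!mul_polyC in R0 *.
    transitivity ((j.+2%:R%:P * C j.+2 + (j%:R + 2 * al)%:P * C j) * (C j * W)); first by ring.
    by rewrite R0; ring.
  have := congr1 (@Intg R) E; rewrite IntgD !IntgZ !IntgCC rho_1_neq ?mulr0 ?add0r//.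
  by apply/eqP; lia.
have X2 j : j.+2%:R * h j.+2 = 2 * (j.+1%:R + al) * x j.+1.
  have E : j.+2%:R *: (C j.+2 * C j.+2 * W) + (j%:R + 2 * al) *: (C j * C j.+2 * W) =
      (2 * (j.+1%:R + al)) *: ('X * C j.+1 * C j.+2 * W).
    have R0 := gegen_rec j; rewrite -!mul_polyC in R0 *.
    transitivity ((j.+2%:R%:P * C j.+2 + (j%:R + 2 * al)%:P * C j) * (C j.+2 * W)); first by ring.
    by rewrite R0; ring.
  have o : (rho R k j j.+2).[1] = 0 by apply: rho_1_neq; apply/eqP; lia.
  by have := congr1 (@Intg R) E; rewrite IntgD !IntgZ !IntgCC o mulr0 addr0.
have xE j : x j = (j%:R + 2 * al) * h j / (2 * (j.+1%:R + al)).
  have j0 := ler0n R j.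
  by rewrite -X1; field; rewrite gt_eqF//; lra.
(* The recurrence starts at $C_2$, so $h_1$ is obtained from [gegen1] instead. *)
case: i i0 => [|i] i0.
  have -> : h 1 = 2 * al * x 0.
    by rewrite /h -IntgCC -IntgZ; congr Intg; rewrite {1}gegen1 -!scalerAl.
  by rewrite xE; field; rewrite gt_eqF//; lra.
have -> : h i.+2 = 2 * (i.+1%:R + al) * x i.+1 / i.+2%:R.
  by rewrite -X2 mulrC mulKf// pnatr_eq0.
rewrite xE -!natr1; field.
have j0 := ler0n R i.
by rewrite !gt_eqF//; lra.
Qed.

Lemma alphE2 : 2 * al = (2 * k).+1%:R.
Proof. by rewrite /alph -[RHS]natr1 natrM; field. Qed.

Lemma nu_succ i : nu R k i.+1 =
  (i%:R + al) * (i%:R + 2 * al) / (i.+1%:R * (i.+1%:R + al)) * nu R k i.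
Proof.
rewrite /nu; have a0 := alph_gt0; have i0 := ler0n R i.
have -> : i.+1%:R + 2 * al = i%:R + 2 * al + 1 by rewrite -natr1; ring.
rewrite GammaS; last lra.
have g0 : Gamma al != 0 by rewrite gt_eqF// Gamma_alph_gt0.
have f0 : i`!%:R != 0 :> R by rewrite pnatr_eq0 -lt0n fact_gt0.
rewrite factS natrM -natr1; field.
by rewrite g0 f0 !gt_eqF//; lra.
Qed.

Lemma nu_gt0 i : 0 < nu R k i.
Proof.
have a0 := alph_gt0; have i0 := ler0n R i.
have g1 : 0 < Gamma (i%:R + 2 * al).
  by rewrite alphE2 -natrD addnS Gamma_nat ltr0n fact_gt0.
have g2 : 0 < Gamma al ^+ 2 by rewrite exprn_gt0// Gamma_alph_gt0.
rewrite /nu; apply: divr_gt0.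
  apply: mulr_gt0 => //; apply: mulr_gt0; first exact: pi_gt0.
  by rewrite powR_gt0.
apply: mulr_gt0 => //; apply: mulr_gt0; first by rewrite ltr0n fact_gt0.
by rewrite ltr_wpDl.
Qed.

End Gegenbauer.

(** * The squared norm of $C_i$ is $\nu_i$ *)

Section Norm.
Variable R : realType.

Let natr23 k : (2 * k + 3)%:R = 2 * k%:R + 3 :> R.
Proof. by rewrite natrD natrM. Qed.

Let natr22 k : (2 * k + 2)%:R = 2 * k%:R + 2 :> R.
Proof. by rewrite natrD natrM. Qed.

Lemma nu0_succ k : nu R k.+1 0 * (2 * k + 3)%:R = (2 * k + 2)%:R * nu R k 0.
Proof.
have a0 := alph_gt0 R k; have k0 := ler0n R k.
have aS : alph R k.+1 = alph R k + 1 by rewrite /alph -natr1; ring.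
have pE l : 2 `^ (1 - 2 * alph R l) = (4 ^+ l)^-1 :> R.
  have -> : 1 - 2 * alph R l = - (2 * l)%:R by rewrite /alph natrM; field.
  by rewrite powRN powR_mulrn// exprM -natrX.
rewrite /nu !pE !add0r fact0 !mul1r aS GammaS//.
have -> : 2 * (alph R k + 1) = 2 * alph R k + 1 + 1 by ring.
rewrite !GammaS; [|lra|lra].
have g0 : Gamma (alph R k) != 0 by rewrite gt_eqF// Gamma_alph_gt0.
have f0 : (4 : R) ^+ k != 0 by rewrite expf_neq0.
rewrite natr23 natr22 exprS.
have -> : k%:R = alph R k - 2^-1 :> R by rewrite /alph; ring.
by field; rewrite g0 f0 !gt_eqF//; lra.
Qed.

Lemma nu00 : nu R 0 0 = 2.
Proof.
rewrite /nu /alph !add0r fact0 mul1r Gamma_half_sqr divff// subrr powRr0 (Gamma_nat R 0) fact0.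
by rewrite !mulr1 invfM invrK mulrCA divff ?mulr1// gt_eqF// pi_gt0.
Qed.

(** The derivative of $z(1-z^2)^{k+1}$ is a combination of the two weights and integrates to 0. *)
Lemma Intg_W_succ k : Intg (Wpoly R k.+1) * (2 * k + 3)%:R = (2 * k + 2)%:R * Intg (Wpoly R k).
Proof.
have E : ('X * Wpoly R k.+1)^`() =
   (2 * k + 3)%:R *: Wpoly R k.+1 + (- (2 * k + 2)%:R) *: Wpoly R k.
  rewrite derivM deriv_w derivX natr23 natr22 /alph -!mul_polyC wE.
  have -> : 2 * (k%:R + 2^-1) + 1 = 2 * k%:R + 2 :> R by field.
  by rewrite !polyCN !polyCD !polyCM !polyC_natr; ring.
have := Intg_deriv ('X * Wpoly R k.+1).
rewrite E IntgD !IntgZ !hornerM w_N1 w_1 !mulr0 subr0 => H.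
lra.
Qed.

Lemma Intg_W0 : Intg (Wpoly R 0) = 2.
Proof.
have -> : Wpoly R 0 = ('X : {poly R})^`() by rewrite derivX /Wpoly expr0.
by rewrite Intg_deriv !hornerX; lra.
Qed.

Lemma Intg_W k : Intg (Wpoly R k) = nu R k 0.
Proof.
elim: k => [|k IH]; first by rewrite Intg_W0 nu00.
apply: (@mulIf _ (2 * k + 3)%:R); first by rewrite pnatr_eq0 addn3.
by rewrite Intg_W_succ nu0_succ IH.
Qed.

(** Two inductions: on $i$ through the common ratio of norms and of $\nu$, and for $i=0$ on $k$
    through [Intg_W]. *)
Lemma rho_1 k i j : (rho R k i j).[1] = (i == j)%:R * nu R k i.
Proof.
have [<-|ij] := eqVneq i j; last by rewrite rho_1_neq// mul0r.
rewrite mul1r; elim: i => [|i IH]; last by rewrite rho_diag_succ IH nu_succ.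
by rewrite -IntgCC gegen0 !mul1r Intg_W.
Qed.

End Norm.

(** * Appending an index, and determinants with a cleared last row or column *)

Section Snoc.

Lemma snoc_lift T n (f : 'I_n -> T) x j : snoc f x (lift ord_max j) = f j.
Proof. by rewrite /snoc liftK. Qed.

Lemma snoc_max T n (f : 'I_n -> T) x : snoc f x ord_max = x.
Proof. by rewrite /snoc unlift_none. Qed.

Lemma snoc_eta T n (f : 'I_n.+1 -> T) : f = snoc (f \o lift ord_max) (f ord_max).
Proof.
apply/funext => j; case: (unliftP ord_max j) => [i ->|->].
  by rewrite snoc_lift.
by rewrite snoc_max.
Qed.

Lemma big_ord_lift_max (V : nmodType) n (F : 'I_n.+1 -> V) :
  \sum_i F i = \sum_i F (lift ord_max i) + F ord_max.
Proof.
rewrite big_ord_recr /=; congr (_ + _); apply: eq_bigr => i _; congr F.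
by apply/esym/val_inj; exact: lift_max.
Qed.

Lemma lift_max_eq n (a b : 'I_n) : (lift ord_max a == lift ord_max b) = (a == b).
Proof. exact: (inj_eq lift_inj). Qed.

Lemma det_col_max (A : comNzRingType) n (M : 'M[A]_n.+1) :
  (forall a, M (lift ord_max a) ord_max = 0) ->
  \det M = M ord_max ord_max * \det (row' ord_max (col' ord_max M)).
Proof.
move=> h; rewrite (expand_det_col _ ord_max) big_ord_lift_max big1 ?add0r; last first.
  by move=> a _; rewrite h mul0r.
by rewrite /cofactor addnn -signr_odd odd_double mul1r.
Qed.

Lemma det_row_max (A : comNzRingType) n (M : 'M[A]_n.+1) :
  (forall a, M ord_max (lift ord_max a) = 0) ->
  \det M = M ord_max ord_max * \det (row' ord_max (col' ord_max M)).
Proof.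
move=> h; rewrite (expand_det_row _ ord_max) big_ord_lift_max big1 ?add0r; last first.
  by move=> a _; rewrite h mul0r.
by rewrite /cofactor addnn -signr_odd odd_double mul1r.
Qed.

End Snoc.

(** * How $\tau$, $C_{m;i}$ and $g_{ij}$ change when an index is appended *)

Section Bordered.
Variables (R : realType) (k : nat).
Implicit Types (n i j c : nat).
Local Notation C := (gegen R k).
Local Notation rho := (rho R k).

Definition rvec n (m : 'I_n -> nat) (t : 'I_n -> R) i : 'rV[{poly R}]_n :=
  \row_b ((t b)%:P * rho i (m b)).

Definition cvec n (m : 'I_n -> nat) j : 'cV[{poly R}]_n := \col_a rho (m a) j.

(** The determinant of [Rmx k m t] bordered by the column [u], the row [rvec m t i] and the corner
    [x], expanded through the adjugate. Both $C_{m;i}$ and $g_{ij}$ have this shape, so one identity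
    serves both. *)
Definition bordered n m t i (u : 'cV[{poly R}]_n) (x : {poly R}) : {poly R} :=
  tau k m t * x - (rvec m t i *m (\adj (Rmx k m t) *m u)) ord0 ord0.

(* pm m t i is C_{m;i} (see [Cmi_pm]), and gm m t i j / tau is the primitive of
   C_{m;i} C_{m;j} W / tau^2 that vanishes at -1 (see [dx_deriv]). *)
Definition pm n m t i : {poly R} :=
  @bordered n m t i (\col_a gegen R k (m a)) (gegen R k i).

Definition gm n m t i j : {poly R} := @bordered n m t i (cvec m j) (rho i j).

Lemma horner_det n (M : 'M[{poly R}]_n) z :
  (\det M).[z] = \det (map_mx (horner_eval z) M).
Proof. by rewrite det_map_mx. Qed.

Lemma tau_N1 n m t : (@tau R k n m t).[-1] = 1.
Proof.
rewrite /tau horner_det; suff -> : map_mx (horner_eval (-1)) (Rmx k m t) = 1%:M by rewrite det1.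
apply/matrixP => a b; rewrite !mxE /horner_eval hornerD hornerZ rho_N1 mulr0 addr0.
by case: eqP => _; rewrite ?hornerC //= -polyC1 hornerC.
Qed.

(** Valid for arbitrary real parameters; this is what permits cancelling $\tau$ in the polynomial
    identities below. *)
Lemma tau_neq0 n m t : @tau R k n m t != 0.
Proof.
apply/eqP => h; have := tau_N1 m t; rewrite h horner0 => /eqP.
by rewrite eq_sym oner_eq0.
Qed.

Section Step.
Variables (n : nat) (m : 'I_n -> nat) (t : 'I_n -> R) (c : nat) (s : R).
Local Notation m' := (snoc m c).
Local Notation t' := (snoc t s).
Local Notation M := (Rmx k m t).
Local Notation M' := (Rmx k m' t').
Local Notation ta := (tau k m t).
Local Notation A := (\adj M).

Lemma Rmx_ll a b : M' (lift ord_max a) (lift ord_max b) = M a b.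
Proof. by rewrite !mxE !snoc_lift lift_max_eq. Qed.

Lemma Rmx_lm a : M' (lift ord_max a) ord_max = s%:P * cvec m c a ord0.
Proof.
by rewrite !mxE !snoc_lift !snoc_max eq_sym (negbTE (neq_lift _ _)) add0r mul_polyC.
Qed.

Lemma Rmx_ml b : M' ord_max (lift ord_max b) = rvec m t c ord0 b.
Proof.
by rewrite !mxE !snoc_lift !snoc_max (negbTE (neq_lift _ _)) add0r mul_polyC.
Qed.

Lemma Rmx_mm : M' ord_max ord_max = 1 + s%:P * rho c c.
Proof. by rewrite !mxE !snoc_max eqxx mul_polyC. Qed.

Lemma mulmx_adj_col (u : 'cV[{poly R}]_n) a : \sum_b M a b * (A *m u) b ord0 = ta * u a ord0.
Proof.
have := congr1 (fun X : 'cV_n => X a ord0) (mulmxA M A u).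
by rewrite /= mul_mx_adj mul_scalar_mx !mxE.
Qed.

Lemma rvec_sum i (u : 'cV[{poly R}]_n) :
  (rvec m t i *m u) ord0 ord0 = \sum_b rvec m t i ord0 b * u b ord0.
Proof. by rewrite mxE. Qed.

Lemma tau_snoc : tau k m' t' = ta + s%:P * gm m t c c.
Proof.
(* A column operation: right multiplication by [N] scales the last column of [M'] by $\tau$ and
   subtracts the combination of the other columns that clears it above the corner. *)
pose N : 'M[{poly R}]_n.+1 := \matrix_(a, b)
  match unlift ord_max a, unlift ord_max b with
  | Some a', Some b' => (a' == b')%:R
  | Some a', None => - s%:P * (A *m cvec m c) a' ord0
  | None, Some _ => 0
  | None, None => ta
  end.
have N_ll a b : N (lift ord_max a) (lift ord_max b) = (a == b)%:R by rewrite mxE !liftK.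
have N_lm a : N (lift ord_max a) ord_max = - s%:P * (A *m cvec m c) a ord0.
  by rewrite mxE liftK unlift_none.
have N_ml b : N ord_max (lift ord_max b) = 0 by rewrite mxE liftK unlift_none.
have N_mm : N ord_max ord_max = ta by rewrite mxE unlift_none.
have dN : \det N = ta.
  rewrite (det_row_max N_ml) N_mm.
  suff -> : row' ord_max (col' ord_max N) = 1%:M by rewrite det1 mulr1.
  by apply/matrixP => a b; rewrite !mxE !liftK.
have P_ll a b : (M' *m N) (lift ord_max a) (lift ord_max b) = M a b.
  rewrite mxE big_ord_lift_max N_ml mulr0 addr0 (bigD1 b) //= N_ll eqxx mulr1 big1 ?addr0 ?Rmx_ll//.
  by move=> b' /negbTE bb; rewrite N_ll bb mulr0.
have P_lm a : (M' *m N) (lift ord_max a) ord_max = 0.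
  rewrite mxE big_ord_lift_max N_mm Rmx_lm.
  under eq_bigr do rewrite Rmx_ll N_lm mulNr mulrN mulrCA.
  by rewrite sumrN -mulr_sumr mulmx_adj_col; ring.
have P_mm : (M' *m N) ord_max ord_max = ta + s%:P * gm m t c c.
  rewrite mxE big_ord_lift_max N_mm Rmx_mm.
  under eq_bigr do rewrite Rmx_ml N_lm mulNr mulrN mulrCA.
  by rewrite sumrN -mulr_sumr -rvec_sum /gm /bordered; ring.
apply: (mulIf (tau_neq0 m t)).
rewrite -[in LHS]dN -det_mulmx (det_col_max P_lm) P_mm; congr (_ * \det _).
by apply/matrixP => a b; rewrite [LHS]mxE [LHS]mxE; exact: P_ll.
Qed.

(* A form of Sylvester's determinant identity; V solves M' V = ta ta' u'. *)
Lemma bordered_snoc i (u' : 'cV[{poly R}]_n.+1) x :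
  let u := \col_a u' (lift ord_max a) ord0 in let uc := u' ord_max ord0 in
  ta * bordered m' t' i u' x
    = tau k m' t' * bordered m t i u x - s%:P * gm m t i c * bordered m t c u uc
  /\ (\adj M' *m u') ord_max ord0 = bordered m t c u uc.
Proof.
move=> u uc; set pc := bordered m t c u uc; set ta' := tau k m' t'.
pose V : 'cV[{poly R}]_n.+1 := \col_a
  if unlift ord_max a is Some a' then
    ta' * (A *m u) a' ord0 - s%:P * pc * (A *m cvec m c) a' ord0
  else ta * pc.
have V_l a : V (lift ord_max a) ord0 =
    ta' * (A *m u) a ord0 - s%:P * pc * (A *m cvec m c) a ord0.
  by rewrite mxE liftK.
have V_m : V ord_max ord0 = ta * pc by rewrite mxE unlift_none.
have MV : M' *m V = (ta * ta') *: u'.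
  apply/matrixP => a b; rewrite (ord1 b) !mxE big_ord_lift_max V_m.
  under eq_bigr do rewrite V_l mulrBr mulrCA [X in _ - X]mulrCA.
  rewrite big_split /= sumrN -!mulr_sumr.
  case: (unliftP ord_max a) => [a' ->|->].
    under eq_bigr do rewrite Rmx_ll.
    under [X in _ - _ * X + _]eq_bigr do rewrite Rmx_ll.
    rewrite !mulmx_adj_col Rmx_lm /u [in ta * (\col_a _) _ _]mxE; ring.
  under eq_bigr do rewrite Rmx_ml.
  under [X in _ - _ * X + _]eq_bigr do rewrite Rmx_ml.
  rewrite -!rvec_sum Rmx_mm -/uc.
  have E1 : (rvec m t c *m (A *m u)) ord0 ord0 = ta * uc - pc by rewrite /pc /bordered; ring.
  have E2 : (rvec m t c *m (A *m cvec m c)) ord0 ord0 = ta * rho c c - gm m t c c.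
    by rewrite /gm /bordered; ring.
  by rewrite E1 E2 /ta' tau_snoc; ring.
have VE : V = ta *: (\adj M' *m u').
  apply/matrixP => a b.
  have := congr1 (fun X : 'cV_n.+1 => X a b) (mulmxA (\adj M') M' V).
  rewrite /= mul_adj_mx mul_scalar_mx MV -scalemxAr [LHS]mxE [RHS]mxE -/(tau k m' t') -/ta'.
  move=> H; apply: (mulfI (tau_neq0 m' t')); rewrite -/ta'.
  by rewrite -H [in RHS]mxE; ring.
have VEa a : ta * (\adj M' *m u') a ord0 = V a ord0 by rewrite VE [RHS]mxE.
split; last first.
  by apply: (mulfI (tau_neq0 m t)); rewrite VEa V_m.
have -> : bordered m' t' i u' x
    = ta' * x - \sum_b rvec m' t' i ord0 b * (\adj M' *m u') b ord0.
  by rewrite /bordered; congr (_ - _); rewrite mxE.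
rewrite big_ord_lift_max mulrBr mulrDr mulr_sumr.
under eq_bigr do rewrite mulrCA VEa V_l mulrBr mulrCA [X in _ - X]mulrCA.
rewrite [ta * (rvec _ _ _ _ _ * _)]mulrCA VEa V_m big_split /= sumrN -!mulr_sumr.
under eq_bigr do rewrite mxE !snoc_lift.
under [X in _ - _ * X + _]eq_bigr do rewrite mxE !snoc_lift.
rewrite [rvec _ _ _ _ ord_max]mxE !snoc_max.
have E1 : \sum_b (t b)%:P * rho i (m b) * (A *m u) b ord0 = ta * x - bordered m t i u x.
  rewrite /bordered rvec_sum; under [in RHS]eq_bigr do rewrite mxE; ring.
have E2 : \sum_b (t b)%:P * rho i (m b) * (A *m cvec m c) b ord0 = ta * rho i c - gm m t i c.
  rewrite /gm /bordered rvec_sum; under [in RHS]eq_bigr do rewrite mxE; ring.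
rewrite E1 E2; ring.
Qed.

Lemma pm_snoc i : ta * pm m' t' i
  = tau k m' t' * pm m t i - s%:P * gm m t i c * pm m t c.
Proof.
have [+ _] := bordered_snoc i (\col_a gegen R k (m' a)) (gegen R k i).
rewrite /pm mxE snoc_max.
have -> : \col_a (\col_a0 gegen R k (m' a0)) (lift ord_max a) ord0 = \col_a gegen R k (m a).
  by apply/matrixP => a b; rewrite !mxE snoc_lift.
by [].
Qed.

Lemma gm_snoc i j : ta * gm m' t' i j
  = tau k m' t' * gm m t i j - s%:P * gm m t i c * gm m t c j.
Proof.
have [+ _] := bordered_snoc i (cvec m' j) (rho i j).
rewrite /gm [cvec m' j ord_max ord0]mxE snoc_max.
have -> : \col_a cvec m' j (lift ord_max a) ord0 = cvec m j.
  by apply/matrixP => a b; rewrite !mxE snoc_lift.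
by [].
Qed.

(** The parameter $s$ occurs only in the last column of the enlarged matrix, and the last row of its
    adjugate consists of cofactors that delete this column; hence the independence of $s$. *)
Lemma Cmi_pm : Cmi k m t s c = pm m t c.
Proof.
(* The second half of [bordered_snoc] does not involve the row index and the corner, so both are set
   to 0. *)
have [_] := bordered_snoc 0 (\col_a gegen R k (m' a)) 0.
rewrite /Cmi /Qvec => ->; rewrite /pm mxE snoc_max; congr (bordered _ _ _ _ _).
by apply/matrixP => a b; rewrite !mxE snoc_lift.
Qed.

End Step.

End Bordered.

(** * The confluent Darboux step preserves the bilinear relations *)

Section Darboux.
Variables (R : realType) (k : nat).
Local Notation al := (alph R k).
Local Notation W := (Wpoly R k).
Local Notation lam := (lam R k).

(** The product [d * (p - q)] vanishes at every point, so at more of the points 0, 1, 2, ... than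
    its degree allows. Polynomial identities can thus be checked pointwise with [d] in
    denominators. *)
Lemma poly_eq_off (d p q : {poly R}) : d != 0 ->
  (forall z, d.[z] != 0 -> p.[z] = q.[z]) -> p = q.
Proof.
move=> d0 h; apply/eqP; rewrite -subr_eq0; apply: contraT => pq.
have r0 : d * (p - q) != 0 by rewrite mulf_neq0.
pose rs := [seq i%:R : R | i <- iota 0 (size (d * (p - q)))].
have /max_poly_roots : all (root (d * (p - q))) rs.
  apply/allP => z _; rewrite rootE hornerM hornerD hornerN.
  have [->|/h ->] := eqVneq d.[z] 0; first by rewrite mul0r.
  by rewrite subrr mulr0.
move=> /(_ r0) H; suff : uniq rs by move=> /H; rewrite size_map size_iota ltnn.
rewrite map_inj_uniq ?iota_uniq// => x y /eqP; by rewrite eqr_nat => /eqP.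
Qed.

(* dx_hirota is T_tau p_i = lam_i p_i multiplied by tau. *)
Record darboux (ta : {poly R}) (p : nat -> {poly R}) (g : nat -> nat -> {poly R}) := Darboux {
  dx_neq0 : ta != 0;
  dx_N1 : forall i j, (g i j).[-1] = 0;
  dx_sym : forall i j, g i j = g j i;
  dx_deriv : forall i j, ta * (g i j)^`() - ta^`() * g i j = W * p i * p j;
  dx_wronskian : forall i j, (lam i - lam j)%:P * g i j * ta =
    (1 - 'X ^+ 2) * W * ((p i)^`() * p j - p i * (p j)^`());
  dx_hirota : forall i,
    (1 - 'X ^+ 2) * (ta * (p i)^`(2) - 2 * ta^`() * (p i)^`() + ta^`(2) * p i)
    - (2 * al + 1)%:P * 'X * ta * (p i)^`() + (2 * al - 1)%:P * 'X * ta^`() * p i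
    = (lam i)%:P * ta * p i }.

(** The Pearson equation of the weight, derived from [deriv_w] so that $k=0$ is no separate case. *)
Lemma W_deriv_horner z : (1 - z ^+ 2) * W^`().[z] = - (2 * al - 1) * z * W.[z].
Proof.
have := deriv_w R k; rewrite wE derivM => /(congr1 (fun q : {poly R} => q.[z])).
move: (Wpoly R k) => V; rewrite derivB derivXn -polyC1 derivC /= !hornerE /= => H; lra.
Qed.

(** Values at one point, with suffixes 1 and 2 for derivatives: [v] is $W$, [T] is $\tau$, [a] and
    [b] are $C_{m;i}$ and $C_{m;c}$, [e] and [f] are $g_{ic}$ and $g_{cc}$, [q] is the new $C_i$.
    The hypotheses eliminate [q], all derivatives of [e], [f], [q], [v], and the second derivatives
    of [a] and [b]. *)
Lemma hirota_step (z v v1 T T1 T2 a a1 a2 b b1 b2 e e1 e2 f f1 f2 q q1 q2 s li lc A : R) :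
  1 - z ^+ 2 != 0 -> T != 0 ->
  (1 - z ^+ 2) * v1 = - (2 * A - 1) * z * v ->
  T * e1 - T1 * e = v * a * b ->
  T * e2 - T2 * e = v1 * a * b + v * (a1 * b + a * b1) ->
  T * f1 - T1 * f = v * b * b ->
  T * f2 - T2 * f = v1 * b * b + 2 * v * b * b1 ->
  (li - lc) * e * T = (1 - z ^+ 2) * v * (a1 * b - a * b1) ->
  (1 - z ^+ 2) * (T * a2 - 2 * T1 * a1 + T2 * a) - (2 * A + 1) * z * T * a1
    + (2 * A - 1) * z * T1 * a = li * T * a ->
  (1 - z ^+ 2) * (T * b2 - 2 * T1 * b1 + T2 * b) - (2 * A + 1) * z * T * b1
    + (2 * A - 1) * z * T1 * b = lc * T * b ->
  T * q = (T + s * f) * a - s * e * b ->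
  T1 * q + T * q1 = (T1 + s * f1) * a + (T + s * f) * a1 - s * (e1 * b + e * b1) ->
  T2 * q + 2 * T1 * q1 + T * q2 = (T2 + s * f2) * a + 2 * (T1 + s * f1) * a1 + (T + s * f) * a2
    - s * (e2 * b + 2 * e1 * b1 + e * b2) ->
  (1 - z ^+ 2) * ((T + s * f) * q2 - 2 * (T1 + s * f1) * q1 + (T2 + s * f2) * q)
    - (2 * A + 1) * z * (T + s * f) * q1 + (2 * A - 1) * z * (T1 + s * f1) * q
  = li * (T + s * f) * q.
Proof.
move=> z0 T0 hv he1 he2 hf1 hf2 h5 ha hb hq hq1 hq2.
have -> : q2 = ((T2 + s * f2) * a + 2 * (T1 + s * f1) * a1 + (T + s * f) * a2
    - s * (e2 * b + 2 * e1 * b1 + e * b2) - T2 * q - 2 * T1 * q1) / T.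
  by rewrite -hq2; field.
have -> : q1 = ((T1 + s * f1) * a + (T + s * f) * a1 - s * (e1 * b + e * b1) - T1 * q) / T.
  by rewrite -hq1; field.
have -> : q = ((T + s * f) * a - s * e * b) / T by rewrite -hq; field.
have -> : a2 = (li * T * a + (2 * A + 1) * z * T * a1 - (2 * A - 1) * z * T1 * a) / ((1 - z ^+ 2) * T)
   + (2 * T1 * a1 - T2 * a) / T.
  by rewrite -ha; field; rewrite z0 T0.
have -> : b2 = (lc * T * b + (2 * A + 1) * z * T * b1 - (2 * A - 1) * z * T1 * b) / ((1 - z ^+ 2) * T)
   + (2 * T1 * b1 - T2 * b) / T.
  by rewrite -hb; field; rewrite z0 T0.
have -> : e2 = (v1 * a * b + v * (a1 * b + a * b1) + T2 * e) / T by rewrite -he2; field.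
have -> : f2 = (v1 * b * b + 2 * v * b * b1 + T2 * f) / T by rewrite -hf2; field.
have -> : e1 = (v * a * b + T1 * e) / T by rewrite -he1; field.
have -> : f1 = (v * b * b + T1 * f) / T by rewrite -hf1; field.
have -> : v1 = - (2 * A - 1) * z * v / (1 - z ^+ 2) by rewrite -hv; field.
apply/eqP; rewrite -subr_eq0; apply/eqP.
(* The difference of the two sides is a multiple of the Wronskian relation h5. *)
transitivity ((T + s * f) * b * s / T ^+ 2 *
  ((li - lc) * e * T - (1 - z ^+ 2) * v * (a1 * b - a * b1))); last by rewrite h5 subrr mulr0.
by field; rewrite z0 T0.
Qed.


Let horner1 (z : R) : (1 : {poly R}).[z] = 1.
Proof. by rewrite -polyC1 hornerC. Qed.

Let hE := (hornerD, hornerN, hornerM, hornerC, hornerX, hornerXn, hornerMn, horner1).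

(** The new polynomials are given only after multiplication by $\tau$. Where $(1-z^2)\tau\neq 0$
    these relations and their derivatives can be solved for the new values, and [poly_eq_off]
    returns to polynomials. *)
Lemma darboux_step (ta ta' : {poly R}) (p p' : nat -> {poly R}) (g g' : nat -> nat -> {poly R})
    (c : nat) (s : R) :
  darboux ta p g -> ta' != 0 -> ta' = ta + s%:P * g c c ->
  (forall i, ta * p' i = ta' * p i - s%:P * g i c * p c) ->
  (forall i j, ta * g' i j = ta' * g i j - s%:P * g i c * g c j) ->
  (forall i j, (g' i j).[-1] = 0) ->
  darboux ta' p' g'.
Proof.
case=> T0 gN gS gD gW gH T0' tE pE gE gN'.
have T0'' : (1 - 'X ^+ 2) * ta != 0.
  rewrite mulf_neq0//; apply/eqP => /(congr1 (fun q : {poly R} => q.[0])).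
  by rewrite !hE expr0n subr0 => /eqP; rewrite oner_eq0.
have pd i z : ta^`().[z] * (p' i).[z] + ta.[z] * (p' i)^`().[z] =
   (ta^`().[z] + s * (g c c)^`().[z]) * (p i).[z] + (ta.[z] + s * (g c c).[z]) * (p i)^`().[z]
   - s * ((g i c)^`().[z] * (p c).[z] + (g i c).[z] * (p c)^`().[z]).
  have := congr1 (fun q : {poly R} => q^`().[z]) (pE i); rewrite tE /=.
  by rewrite !(derivM, derivB, derivD, derivC) !hE /= => ->; ring.
have pd2 i z : ta^`(2).[z] * (p' i).[z] + 2 * ta^`().[z] * (p' i)^`().[z] + ta.[z] * (p' i)^`(2).[z] =
   (ta^`(2).[z] + s * (g c c)^`(2).[z]) * (p i).[z]
   + 2 * (ta^`().[z] + s * (g c c)^`().[z]) * (p i)^`().[z]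
   + (ta.[z] + s * (g c c).[z]) * (p i)^`(2).[z]
   - s * ((g i c)^`(2).[z] * (p c).[z] + 2 * (g i c)^`().[z] * (p c)^`().[z]
     + (g i c).[z] * (p c)^`(2).[z]).
  have := congr1 (fun q : {poly R} => q^`(2).[z]) (pE i); rewrite tE /=.
  rewrite ?derivnS ?derivn0 !(derivM, derivB, derivD, derivC) !hE /= => H.
  apply: eq_trans (eq_trans H _); ring.
have p0 i z : ta.[z] * (p' i).[z] = (ta.[z] + s * (g c c).[z]) * (p i).[z] - s * (g i c).[z] * (p c).[z].
  by have := congr1 (fun q : {poly R} => q.[z]) (pE i); rewrite tE /= !hE /=.
have g0 i j z : ta.[z] * (g' i j).[z] = (ta.[z] + s * (g c c).[z]) * (g i j).[z] - s * (g i c).[z] * (g c j).[z].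
  by have := congr1 (fun q : {poly R} => q.[z]) (gE i j); rewrite tE /= !hE /=.
have gd i j z : ta^`().[z] * (g' i j).[z] + ta.[z] * (g' i j)^`().[z] =
   (ta^`().[z] + s * (g c c)^`().[z]) * (g i j).[z] + (ta.[z] + s * (g c c).[z]) * (g i j)^`().[z]
   - s * ((g i c)^`().[z] * (g c j).[z] + (g i c).[z] * (g c j)^`().[z]).
  have := congr1 (fun q : {poly R} => q^`().[z]) (gE i j); rewrite tE /=.
  by rewrite !(derivM, derivB, derivD, derivC) !hE /= => ->; ring.
have hD i j z : ta.[z] * (g i j)^`().[z] - ta^`().[z] * (g i j).[z] = W.[z] * (p i).[z] * (p j).[z].
  by have := congr1 (fun q : {poly R} => q.[z]) (gD i j); rewrite /= !hE /=.
have hD2 i j z : ta.[z] * (g i j)^`(2).[z] - ta^`(2).[z] * (g i j).[z] =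
    W^`().[z] * (p i).[z] * (p j).[z] + W.[z] * ((p i)^`().[z] * (p j).[z] + (p i).[z] * (p j)^`().[z]).
  have := congr1 (fun q : {poly R} => q^`().[z]) (gD i j); rewrite /=.
  rewrite ?derivnS ?derivn0 !(derivM, derivB, derivD, derivC) !hE /= => H.
  apply: eq_trans (eq_trans H _); ring.
have hW i j z : (lam i - lam j) * (g i j).[z] * ta.[z] =
    (1 - z ^+ 2) * W.[z] * ((p i)^`().[z] * (p j).[z] - (p i).[z] * (p j)^`().[z]).
  by have := congr1 (fun q : {poly R} => q.[z]) (gW i j); rewrite /= !hE /=.
have hH i z : (1 - z ^+ 2) * (ta.[z] * (p i)^`(2).[z] - 2 * ta^`().[z] * (p i)^`().[z] + ta^`(2).[z] * (p i).[z])
    - (2 * al + 1) * z * ta.[z] * (p i)^`().[z] + (2 * al - 1) * z * ta^`().[z] * (p i).[z]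
    = lam i * ta.[z] * (p i).[z].
  have := congr1 (fun q : {poly R} => q.[z]) (gH i); rewrite /= !hE /= => H.
  by apply: eq_trans (eq_trans H _); rewrite ?mulr2n; ring.
have off z : ((1 - 'X ^+ 2) * ta).[z] != 0 -> 1 - z ^+ 2 != 0 /\ ta.[z] != 0.
  by rewrite hornerM mulf_eq0 negb_or !hE => /andP[].
split=> //.
- move=> i j; apply: (mulfI T0); rewrite !gE gS [g j c]gS [g c i]gS [g c j]gS; ring.
- move=> i j; apply: (poly_eq_off T0'') => z /off[_ t0].
  rewrite tE !(derivD, derivM, derivC) !hE /=.
  have := p0 i z; have := p0 j z; have := g0 i j z; have := gd i j z.
  have := hD i j z; have := hD i c z; have := hD c j z; have := hD c c z.
  rewrite [g j c]gS.
  move: (ta.[z]) (ta^`().[z]) t0 => T T1 t0.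
  move: ((g c c).[z]) ((g c c)^`().[z]) ((g i c).[z]) ((g i c)^`().[z]) => f f1 e e1.
  move: ((g c j).[z]) ((g c j)^`().[z]) ((g i j).[z]) ((g i j)^`().[z]) => h h1 G G1.
  move: ((g' i j).[z]) ((g' i j)^`().[z]) ((p' i).[z]) ((p' j).[z]) => G' G1' q r.
  move: ((p i).[z]) ((p j).[z]) ((p c).[z]) (W.[z]) => a d b v.
  move=> hf hh he hG hG' hG0 hr hq.
  have -> : G1' = ((T1 + s * f1) * G + (T + s * f) * G1 - s * (e1 * h + e * h1) - T1 * G') / T.
    by rewrite -hG'; field.
  have -> : G' = ((T + s * f) * G - s * e * h) / T by rewrite -hG0; field.
  have -> : q = ((T + s * f) * a - s * e * b) / T by rewrite -hq; field.
  have -> : r = ((T + s * f) * d - s * h * b) / T by rewrite -hr; field.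
  have -> : e1 = (v * a * b + T1 * e) / T by rewrite -he; field.
  have -> : h1 = (v * b * d + T1 * h) / T by rewrite -hh; field.
  have -> : G1 = (v * a * d + T1 * G) / T by rewrite -hG; field.
  have -> : f1 = (v * b * b + T1 * f) / T by rewrite -hf; field.
  by field.
- move=> i j; apply: (poly_eq_off T0'') => z /off[_ t0].
  rewrite tE !hE /=.
  have := p0 i z; have := p0 j z; have := pd i z; have := pd j z; have := g0 i j z.
  have := hD i c z; have := hD c j z; have := hD c c z.
  have := hW i j z; have := hW i c z; have := hW c j z.
  rewrite [g j c]gS.
  move: (lam i) (lam j) (lam c) => li lj lc.
  move: (ta.[z]) (ta^`().[z]) t0 => T T1 t0.
  move: ((g c c).[z]) ((g c c)^`().[z]) ((g i c).[z]) ((g i c)^`().[z]) => f f1 e e1.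
  move: ((g c j).[z]) ((g c j)^`().[z]) ((g i j).[z]) => h h1 G.
  move: ((g' i j).[z]) ((p' i).[z]) ((p' j).[z]) ((p' i)^`().[z]) ((p' j)^`().[z]) => G' q r q1 r1.
  move: ((p i).[z]) ((p j).[z]) ((p c).[z]) (W.[z]) => a d b v.
  move: ((p i)^`().[z]) ((p j)^`().[z]) ((p c)^`().[z]) => a1 d1 b1.
  move=> wcj wic wij hf hh he hG0 hr1 hq1 hr hq.
  have -> : q1 = ((T1 + s * f1) * a + (T + s * f) * a1 - s * (e1 * b + e * b1) - T1 * q) / T.
    by rewrite -hq1; field.
  have -> : r1 = ((T1 + s * f1) * d + (T + s * f) * d1 - s * (h1 * b + h * b1) - T1 * r) / T.
    by rewrite -hr1; field.
  have -> : G' = ((T + s * f) * G - s * e * h) / T by rewrite -hG0; field.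
  have -> : q = ((T + s * f) * a - s * e * b) / T by rewrite -hq; field.
  have -> : r = ((T + s * f) * d - s * h * b) / T by rewrite -hr; field.
  have -> : e1 = (v * a * b + T1 * e) / T by rewrite -he; field.
  have -> : h1 = (v * b * d + T1 * h) / T by rewrite -hh; field.
  have -> : f1 = (v * b * b + T1 * f) / T by rewrite -hf; field.
  (* The new Wronskian relation is a combination of the three old ones, for the pairs $(i,j)$,
     $(i,c)$ and $(c,j)$. *)
  apply/eqP; rewrite -subr_eq0; apply/eqP.
  transitivity ((T + s * f) / T ^+ 2 *
    ((T + s * f) * ((li - lj) * G * T - (1 - z ^+ 2) * v * (a1 * d - a * d1))
     - s * h * ((li - lc) * e * T - (1 - z ^+ 2) * v * (a1 * b - a * b1))
     - s * e * ((lc - lj) * h * T - (1 - z ^+ 2) * v * (b1 * d - b * d1))));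
    last by rewrite wij wic wcj !subrr !mulr0 !subr0 mulr0.
  by field.
- move=> i; apply: (poly_eq_off T0'') => z /off[z0 t0].
  rewrite tE ?derivnS ?derivn0 !(derivD, derivM, derivC) !hE /=.
  have := @hirota_step z W.[z] W^`().[z] ta.[z] ta^`().[z] ta^`(2).[z]
    (p i).[z] (p i)^`().[z] (p i)^`(2).[z] (p c).[z] (p c)^`().[z] (p c)^`(2).[z]
    (g i c).[z] (g i c)^`().[z] (g i c)^`(2).[z] (g c c).[z] (g c c)^`().[z] (g c c)^`(2).[z]
    (p' i).[z] (p' i)^`().[z] (p' i)^`(2).[z] s (lam i) (lam c) al z0 t0
    (W_deriv_horner z) (hD i c z) (hD2 i c z) (hD c c z).
  have h2 := hD2 c c z.
  move=> /(_ _ (hW i c z) (hH i z) (hH c z) (p0 i z) (pd i z) (pd2 i z)) H.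
  rewrite ?derivnS ?derivn0 in H h2 *.
  apply: eq_trans (eq_trans (H _) _); [ring| |ring].
  by rewrite h2; ring.
Qed.

Lemma darboux_base : darboux 1 (gegen R k) (rho R k).
Proof.
split.
- exact: oner_neq0.
- by move=> i j; rewrite rho_N1.
- by move=> i j; rewrite rho_sym.
- by move=> i j; rewrite deriv_rho -polyC1 derivC; ring.
- by move=> i j; rewrite mulr1 mul_polyC rho_wronskian wE.
- move=> i; have := gegen_ode R k i; rewrite -!mul_polyC => E.
  transitivity ((lam i)%:P * gegen R k i); last by rewrite mulr1.
  rewrite -E.
  by rewrite ?derivnS ?derivn0 -polyC1 !derivC polyC1; ring.
Qed.

Lemma darboux_pm n (m : 'I_n -> nat) t : darboux (tau k m t) (pm k m t) (gm k m t).
Proof.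
elim: n m t => [|n IH] m t.
  have t1 : tau k m t = 1 by rewrite /tau det_mx00.
  have E i (u : 'cV[{poly R}]_0) x : bordered k m t i u x = x.
    by rewrite /bordered t1 mul1r mxE big_ord0 subr0.
  have -> : pm k m t = gegen R k by apply/funext => i; rewrite /pm E.
  have -> : gm k m t = rho R k by apply/funext => i; apply/funext => j; rewrite /gm E.
  by rewrite t1; exact: darboux_base.
have gN i j : (gm k m t i j).[-1] = 0.
  rewrite /gm /bordered hornerD hornerN hornerM rho_N1 mulr0 mxE horner_sum big1 ?subr0//.
  by move=> b _; rewrite mxE !hornerM rho_N1 mulr0 mul0r.
move: gN; rewrite (snoc_eta m) (snoc_eta t) => gN.
apply: (darboux_step (c := m ord_max) (s := t ord_max) (IH (m \o lift ord_max) (t \o lift ord_max))).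
- exact: tau_neq0.
- exact: tau_snoc.
- by move=> i; exact: pm_snoc.
- by move=> i j; exact: gm_snoc.
- exact: gN.
Qed.

End Darboux.

(** * Sign and monotonicity of quotients of polynomials on $[-1,1]$ *)

Section RationalMono.
Variable R : realType.
Implicit Types p q A B : {poly R}.

Definition nonvanishing p := forall z : R, -1 <= z <= 1 -> p.[z] != 0.

Lemma nonvanishing_gt0 p : nonvanishing p -> p.[-1] = 1 ->
  forall z : R, -1 <= z <= 1 -> 0 < p.[z].
Proof.
move=> h h1 z /andP[z1 z2]; rewrite ltNge; apply/negP => pz.
have [x /andP[x1 x2]] : exists2 x, -1 <= x <= z & root (- p) x.
  by apply: Num.Theory.poly_ivt => //; rewrite !hornerN h1 oppr_ge0 pz lerNl oppr0 ler01.
rewrite rootE hornerN oppr_eq0 => px.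
by have := h x; rewrite x1 (le_trans x2 z2) px => /(_ isT).
Qed.

Lemma is_derive_horner p (x : R) : is_derive x 1 (fun z => p.[z]) p^`().[x].
Proof.
split; first exact: derivable_horner.
by rewrite derivE derive1E.
Qed.

Lemma is_derive_ratio A B (x : R) : B.[x] != 0 ->
  is_derive x 1 (fun z => A.[z] / B.[z]) ((A^`() * B - A * B^`()).[x] / B.[x] ^+ 2).
Proof.
move=> Bx; have dA := is_derive_horner A x; have dB := is_derive_horner B x.
have dV := is_deriveV Bx dB.
apply: is_derive_eq; rewrite /GRing.scale /= !(hornerD, hornerN, hornerM).
by field.
Qed.

Lemma ratio_homo A B : nonvanishing B ->
  (forall z : R, -1 <= z <= 1 -> 0 <= (A^`() * B - A * B^`()).[z]) ->
  forall x y : R, -1 <= x -> x <= y -> y <= 1 -> A.[x] / B.[x] <= A.[y] / B.[y].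
Proof.
move=> B0 h; apply: ger0_derive1_ndecr.
- move=> x; rewrite in_itv/= => /andP[x1 x2].
  by apply: ex_derive; apply: is_derive_ratio; apply: B0; rewrite !ltW.
- move=> x; rewrite in_itv/= => /andP[x1 x2]; have xI : -1 <= x <= 1 by rewrite !ltW.
  have -> : ((fun z : R => A.[z] / B.[z])^`())%classic x
      = (A^`() * B - A * B^`()).[x] / B.[x] ^+ 2.
    by rewrite derive1E; apply: derive_val; exact: is_derive_ratio (B0 x xI).
  by rewrite divr_ge0 ?sqr_ge0 ?h.
- apply: continuous_in_subspaceT => x; rewrite inE /= in_itv /= => xI.
  exact: is_derive_continuous (is_derive_ratio A (B0 x xI)).
Qed.

Lemma Wpoly_ge0 k (z : R) : -1 <= z <= 1 -> 0 <= (Wpoly R k).[z].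
Proof.
move=> zI; rewrite /Wpoly horner_exp exprn_ge0// !hornerE.
case/andP: zI => z1 z2; have -> : 1 - z ^+ 2 = (1 - z) * (1 + z) by ring.
by rewrite mulr_ge0//; lra.
Qed.

End RationalMono.

(** * Zeros of $\tau$, values at 1, and norms *)

Section Values.
Variables (R : realType) (k : nat).
Local Notation nu := (nu R k).
Local Notation tau := (tau k).
Local Notation pm := (pm k).
Local Notation gm := (gm k).

Definition admissible n (m : 'I_n -> nat) (t : 'I_n -> R) :=
  forall j, - (nu (m j))^-1 < t j.

Lemma admissibleE i (s : R) : (- (nu i)^-1 < s) = (0 < 1 + s * nu i).
Proof.
have n0 := nu_gt0 R k i.
rewrite -[in RHS](ltr_pM2r (x := (nu i)^-1)) ?invr_gt0// mul0r mulrDl mul1r mulfK ?gt_eqF//.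
by rewrite -ltrBlDl sub0r.
Qed.

Lemma delta_t_in n (m : 'I_n -> nat) (t : 'I_n -> R) a : injective m -> delta_t m t (m a) = t a.
Proof.
move=> mI; rewrite /delta_t; case: pickP => [j /eqP/mI ->//|/(_ a)].
by rewrite eqxx.
Qed.

Lemma delta_t_notin n (m : 'I_n -> nat) (t : 'I_n -> R) i : (forall a, m a != i) -> delta_t m t i = 0.
Proof. by move=> h; rewrite /delta_t; case: pickP => [j|//]; rewrite (negbTE (h j)). Qed.

Lemma rvec_1 n (m : 'I_n -> nat) (t : 'I_n -> R) i b :
  (rvec k m t i ord0 b).[1] = t b * ((i == m b)%:R * nu i).
Proof. by rewrite mxE hornerM hornerC rho_1. Qed.

(** At $z=1$ orthogonality makes the matrix diagonal with entries $1+t_a\nu_{m_a}$, and the border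
    row keeps at most its entry with $m_a=i$. The factor $1+t_i\nu_i$ is multiplied out because it
    may vanish here. *)
Lemma gm_1 n (m : 'I_n -> nat) (t : 'I_n -> R) i : injective m ->
  (gm m t i i).[1] * (1 + delta_t m t i * nu i) = (tau m t).[1] * nu i.
Proof.
move=> mI; have [[a ma]|h] := pselect (exists a, m a = i); last first.
  have h' a : m a != i by apply/eqP => E; apply: h; exists a.
  rewrite delta_t_notin// mul0r addr0 mulr1 /gm /bordered hornerD hornerN hornerM rho_1 eqxx mul1r.
  have -> : ((rvec k m t i *m (\adj (Rmx k m t) *m cvec R k m i)) ord0 ord0).[1] = 0.
    rewrite rvec_sum horner_sum big1// => b _.
    by rewrite hornerM rvec_1 eq_sym (negbTE (h' b)) mul0r mulr0 mul0r.
  by rewrite subr0.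
rewrite -ma delta_t_in//.
pose v := (\adj (Rmx k m t) *m cvec R k m (m a)) a ord0.
have E1 : ((rvec k m t (m a) *m (\adj (Rmx k m t) *m cvec R k m (m a))) ord0 ord0).[1]
    = t a * nu (m a) * v.[1].
  rewrite rvec_sum horner_sum (bigD1 a)//= big1 ?addr0; last first.
    move=> b ba; rewrite hornerM rvec_1 (inj_eq mI) eq_sym (negbTE ba).
    by rewrite mul0r mulr0 mul0r.
  by rewrite hornerM rvec_1 eqxx mul1r.
have E2 : (1 + t a * nu (m a)) * v.[1] = (tau m t).[1] * nu (m a).
  have := congr1 (fun p : {poly R} => p.[1]) (mulmx_adj_col k m t (cvec R k m (m a)) a).
  rewrite /= [in RHS]hornerM [in RHS]mxE rho_1 eqxx mul1r => <-.
  rewrite horner_sum (bigD1 a)//= big1 ?addr0; last first.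
    move=> b ba; rewrite hornerM mxE hornerD hornerZ rho_1 (inj_eq mI) eq_sym (negbTE ba).
    by rewrite mul0r mulr0 hornerC addr0 mul0r.
  by rewrite hornerM mxE hornerD hornerZ rho_1 !eqxx mul1r -polyC1 hornerC.
rewrite /gm /bordered hornerD hornerN hornerM rho_1 eqxx mul1r E1.
transitivity ((tau m t).[1] * nu (m a) * (1 + t a * nu (m a))
  - t a * nu (m a) * ((1 + t a * nu (m a)) * v.[1])); first by ring.
rewrite E2; ring.
Qed.

(** Iterated, this gives $\tau(1)=\prod_j(1+t_j\nu_{m_j})$. *)
Lemma tau_snoc_1 n (m : 'I_n -> nat) (t : 'I_n -> R) c s : injective (snoc m c) ->
  (tau (snoc m c) (snoc t s)).[1] = (tau m t).[1] * (1 + s * nu c).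
Proof.
move=> mI.
have m0I : injective m.
  by move=> a b E; apply: (@lift_inj _ ord_max); apply: mI; rewrite !snoc_lift.
have := gm_1 t c m0I; rewrite delta_t_notin; last first.
  move=> a; apply/eqP => E; have := mI (lift ord_max a) ord_max.
  by rewrite snoc_lift snoc_max => /(_ E)/eqP; rewrite eq_sym (negbTE (neq_lift _ _)).
rewrite mul0r addr0 mulr1 tau_snoc hornerD hornerM hornerC => ->; ring.
Qed.

Lemma injective_snoc n (m : 'I_n -> nat) c : injective (snoc m c) -> injective m.
Proof.
by move=> mI a b E; apply: (@lift_inj _ ord_max); apply: mI; rewrite !snoc_lift.
Qed.

Lemma tau_deriv_step n (m : 'I_n -> nat) (t : 'I_n -> R) c s :
  (tau (snoc m c) (snoc t s))^`() * tau m t - tau (snoc m c) (snoc t s) * (tau m t)^`()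
  = s%:P * (Wpoly R k * pm m t c ^+ 2).
Proof.
have := dx_deriv (darboux_pm k m t) c c.
move=> H; rewrite expr2 [Wpoly R k * _]mulrA -H tau_snoc derivD derivM derivC; ring.
Qed.

(** The quotient $F$ is bounded below by its smaller end value: $F(-1)=1$ if $s\ge 0$, and
    $F(1)=1+s\nu_c$ if $s<0$. *)
Lemma nonvanishing_snoc n (m : 'I_n -> nat) (t : 'I_n -> R) c s : injective (snoc m c) ->
  nonvanishing (tau m t) -> 0 < 1 + s * nu c -> nonvanishing (tau (snoc m c) (snoc t s)).
Proof.
move=> mI h hs z /andP[z1 z2].
(* The sign [sg] makes $sF$ monotone in one direction, covering both signs of $s$ at once. *)
have mono : forall sg : R, 0 <= sg * s ->
    forall x y : R, -1 <= x -> x <= y -> y <= 1 ->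
    (sg%:P * tau (snoc m c) (snoc t s)).[x] / (tau m t).[x] <=
    (sg%:P * tau (snoc m c) (snoc t s)).[y] / (tau m t).[y].
  move=> sg sgs; apply: ratio_homo => // x xI.
  have -> : (sg%:P * tau (snoc m c) (snoc t s))^`() * tau m t -
     sg%:P * tau (snoc m c) (snoc t s) * (tau m t)^`() =
     sg%:P * (s%:P * (Wpoly R k * pm m t c ^+ 2)).
    by rewrite -tau_deriv_step derivM derivC; ring.
  rewrite mulrA hornerM hornerM !hornerC hornerM mulr_ge0// mulr_ge0 ?Wpoly_ge0//.
  by rewrite horner_exp sqr_ge0.
have t1 : 0 < (tau m t).[1] by apply: nonvanishing_gt0 => //; [exact: tau_N1|lra].
have tz : 0 < (tau m t).[z].
  by apply: nonvanishing_gt0 => //; [exact: tau_N1|rewrite z1].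
rewrite gt_eqF//.
have [s0|s0] := leP 0 s.
  have := mono 1 _ (-1) z (lexx _) z1 z2; rewrite mul1r => /(_ s0).
  by rewrite !mul1r !tau_N1 divr1 ler_pdivlMr// mul1r; apply: lt_le_trans.
have := mono (-1) _ z 1 z1 z2 (lexx _); rewrite mulN1r oppr_ge0 (ltW s0) => /(_ isT).
rewrite !hornerM !hornerC !mulN1r !mulNr lerN2 tau_snoc_1// mulrAC divff ?gt_eqF// mul1r.
by rewrite ler_pdivlMr//; apply: lt_le_trans; rewrite mulr_gt0.
Qed.

Lemma admissible_nonvanishing n (m : 'I_n -> nat) (t : 'I_n -> R) : injective m ->
  admissible m t -> nonvanishing (tau m t).
Proof.
elim: n m t => [|n IH] m t mI ad z zI.
  by rewrite /Defs.tau det_mx00 -polyC1 hornerC oner_eq0.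
move: z zI; rewrite -/(nonvanishing _); move: mI ad.
rewrite (snoc_eta m) (snoc_eta t) => mI ad.
apply: nonvanishing_snoc => //.
  apply: IH; first exact: injective_snoc mI.
  by move=> j; have := ad (lift ord_max j); rewrite !snoc_lift.
by have := ad ord_max; rewrite !snoc_max admissibleE.
Qed.

(* For s < 0, the ratio of tau to the new tau is nondecreasing on [-1, 1] and equals 1 at -1. *)
Lemma nonvanishing_unsnoc n (m : 'I_n -> nat) (t : 'I_n -> R) c s : s < 0 ->
  nonvanishing (tau (snoc m c) (snoc t s)) -> nonvanishing (tau m t).
Proof.
move=> s0 h z /andP[z1 z2].
have : (tau m t).[-1] / (tau (snoc m c) (snoc t s)).[-1]
    <= (tau m t).[z] / (tau (snoc m c) (snoc t s)).[z].
  apply: ratio_homo => // x xI.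
  have -> : (tau m t)^`() * tau (snoc m c) (snoc t s) - tau m t * (tau (snoc m c) (snoc t s))^`()
    = (- s)%:P * (Wpoly R k * pm m t c ^+ 2).
    by rewrite polyCN mulNr -tau_deriv_step; ring.
  rewrite hornerM hornerC hornerM mulr_ge0 ?oppr_ge0 ?(ltW s0)// mulr_ge0 ?Wpoly_ge0//.
  by rewrite horner_exp sqr_ge0.
have tz : 0 < (tau (snoc m c) (snoc t s)).[z].
  by apply: nonvanishing_gt0 => //; [exact: tau_N1|rewrite z1].
rewrite !tau_N1 divr1 ler_pdivlMr// mul1r => H.
by rewrite gt_eqF//; apply: lt_le_trans H.
Qed.

(** Rows and columns are permuted alike, so the two signs cancel. It allows any chosen index to be
    treated as the last one. *)
Lemma tau_perm n (m : 'I_n -> nat) (t : 'I_n -> R) (s : {perm 'I_n}) :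
  tau (m \o s) (t \o s) = tau m t.
Proof.
rewrite /Defs.tau.
have -> : Rmx k (m \o s) (t \o s) = row_perm s (col_perm s (Rmx k m t)).
  by apply/matrixP => a b; rewrite !mxE (inj_eq perm_inj).
rewrite row_permE col_permE !det_mulmx !det_perm mulrC -mulrA -signr_addb.
by rewrite odd_permV addbb mulr1.
Qed.

(** Some negative parameter is moved to the end and removed; the shorter $\tau$ is still without
    zeros. Both determinants are then positive at 1, and so is their quotient $1+s\nu_c$. *)
Lemma nonvanishing_admissible n (m : 'I_n -> nat) (t : 'I_n -> R) : injective m ->
  nonvanishing (tau m t) -> admissible m t.
Proof.
elim: n m t => [|n IH] m t mI h; first by case.
have [[c tc]|H] := pselect (exists c, t c < 0); last first.
  move=> j; rewrite admissibleE; have n0 := nu_gt0 R k (m j).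
  have tj : 0 <= t j by rewrite leNgt; apply/negP => tj; apply: H; exists j.
  by have := mulr_ge0 tj (ltW n0); lra.
pose sg := tperm c ord_max.
have mI' : injective (m \o sg) by apply: inj_comp => //; exact: perm_inj.
have h' : nonvanishing (tau (m \o sg) (t \o sg)) by rewrite tau_perm.
suff ad : admissible (m \o sg) (t \o sg).
  by move=> j; have := ad (sg j); rewrite /= tpermK.
have tm : (t \o sg) ord_max < 0 by rewrite /= /sg tpermR.
move: (m \o sg) (t \o sg) mI' h' tm => m1 t1 mI1 h1 tm j.
have h1' := h1; rewrite (snoc_eta m1) (snoc_eta t1) in h1' mI1.
have h0 := nonvanishing_unsnoc tm h1'.
have ad0 := IH _ _ (injective_snoc mI1) h0.
case: (unliftP ord_max j) => [i ->|->]; first exact: ad0.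
have p1 : 0 < (tau m1 t1).[1].
  by rewrite (snoc_eta m1) (snoc_eta t1); apply: nonvanishing_gt0 => //; [exact: tau_N1|lra].
have p0 : 0 < (tau (m1 \o lift ord_max) (t1 \o lift ord_max)).[1].
  by apply: nonvanishing_gt0 => //; [exact: tau_N1|lra].
rewrite admissibleE; move: p1; rewrite (snoc_eta m1) (snoc_eta t1) tau_snoc_1// !snoc_max.
by rewrite pmulr_rgt0.
Qed.

Lemma integral_pm_sqr n (m : 'I_n -> nat) (t : 'I_n -> R) i : injective m -> admissible m t ->
  (\int[@lebesgue_measure R]_(u in `[(-1)%R, 1%R])
     (((pm m t i).[u]) ^+ 2 * Wtau k (tau m t) u)%:E)%E
  = (nu i / (1 + delta_t m t i * nu i))%:E.
Proof.
move=> mI ad; have h := admissible_nonvanishing mI ad.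
have D := darboux_pm k m t.
have d0 : 0 < 1 + delta_t m t i * nu i.
  rewrite /delta_t; case: pickP => [j /eqP <-|_]; first by rewrite -admissibleE.
  by rewrite mul0r addr0.
have t1 : 0 < (tau m t).[1] by apply: nonvanishing_gt0 => //; [exact: tau_N1|lra].
have E (u : R) : ((pm m t i).[u]) ^+ 2 * Wtau k (tau m t) u =
   ((gm m t i i)^`() * tau m t - gm m t i i * (tau m t)^`()).[u] / (tau m t).[u] ^+ 2.
  have := dx_deriv D i i => H.
  have -> : (gm m t i i)^`() * tau m t - gm m t i i * (tau m t)^`() = Wpoly R k * pm m t i ^+ 2.
    by rewrite expr2 mulrA -H; ring.
  by rewrite hornerM /Wpoly !horner_exp !hornerE /= /Wtau; ring.
have -> : nu i / (1 + delta_t m t i * nu i) =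
    (gm m t i i).[1] / (tau m t).[1] - (gm m t i i).[-1] / (tau m t).[-1].
  rewrite (dx_N1 D) mul0r subr0; apply/eqP.
  by rewrite (eqr_div _ _ (lt0r_neq0 d0) (lt0r_neq0 t1)) (gm_1 t i mI) mulrC.
apply: (@FTC2_segment _ _ (fun z => (gm m t i i).[z] / (tau m t).[z])).
- by lra.
- move=> x; rewrite in_itv/= => xI; rewrite E; exact: is_derive_ratio (h x xI).
- move=> x; rewrite in_itv/= => xI; rewrite (funext E).
  pose B2 := tau m t ^+ 2.
  pose A2 := (gm m t i i)^`() * tau m t - gm m t i i * (tau m t)^`().
  rewrite -/A2; have -> : (fun u : R => A2.[u] / (tau m t).[u] ^+ 2) = (fun u => A2.[u] / B2.[u]).
    by apply/funext => u; rewrite /B2 horner_exp.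
  apply: is_derive_continuous; apply: is_derive_ratio.
  by rewrite /B2 horner_exp expf_neq0// h.
Qed.

End Values.

(** * Degrees from the bilinear eigenvalue equation *)

Section Degrees.
Variables (R : realType) (k : nat).

Lemma coefM_top (P Q : {poly R}) a b : (size P <= a.+1)%N -> (size Q <= b.+1)%N ->
  (P * Q)`_(a + b) = P`_a * Q`_b.
Proof.
move=> sP sQ; have aL : (a < (a + b).+1)%N by lia.
rewrite coefM (bigD1 (Ordinal aL))//= addKn big1 ?addr0// => j ja.
have [ja'|ja'] := ltnP a j.
  by rewrite nth_default ?mul0r//; apply: leq_trans sP _.
rewrite [Q`_ _]nth_default ?mulr0//; apply: leq_trans sQ _.
have : (j : nat) != a by apply: contra ja => /eqP E; apply/eqP/val_inj.
by move=> /eqP; lia.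
Qed.

(** With $N=\deg p$ and $M=\deg\tau$, the coefficient of $z^{M+N}$ gives
    $(N-M)^2+2\alpha(N-M)=i^2+2\alpha i$, that is $(N-M-i)(N-M+i+2\alpha)=0$, where
    $2\alpha=2k+1$. *)
Lemma hirota_degree (ta p : {poly R}) i : ta != 0 -> p != 0 ->
  (1 - 'X ^+ 2) * (ta * p^`(2) - 2 * ta^`() * p^`() + ta^`(2) * p)
    - (2 * alph R k + 1)%:P * 'X * ta * p^`() + (2 * alph R k - 1)%:P * 'X * ta^`() * p
    = (lam R k i)%:P * ta * p ->
  let N := (size p).-1 in let M := (size ta).-1 in N = (M + i)%N \/ (N + i + 2 * k + 1)%N = M.
Proof.
move=> t0 p0 H N M.
have sN : (size p <= N.+1)%N by rewrite /N prednK// size_poly_gt0.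
have sM : (size ta <= M.+1)%N by rewrite /M prednK// size_poly_gt0.
have lN : p`_N != 0 by rewrite -/(lead_coef p) lead_coef_eq0.
have lM : ta`_M != 0 by rewrite -/(lead_coef ta) lead_coef_eq0.
have cX1 (q : {poly R}) j : ('X * q^`())`_j = j%:R * q`_j.
  by rewrite coefXM coef_deriv; case: j => [|j] /=; rewrite ?mul0r// mulr_natl.
have cX2 (q : {poly R}) j : ('X^2 * q^`(2))`_j = j%:R * (j%:R - 1) * q`_j.
  rewrite coefXnM !derivnS derivn0 !coef_deriv; case: j => [|[|j]] /=.
  - ring.
  - ring.
  - rewrite !subSS subn0; ring.
have sX1 (q : {poly R}) n : (size q <= n.+1)%N -> (size ('X * q^`())%R <= n.+1)%N.
  by move=> /leq_sizeP h; apply/leq_sizeP => j /h; rewrite cX1 => ->; rewrite mulr0.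
have sX2 (q : {poly R}) n : (size q <= n.+1)%N -> (size ('X^2 * q^`(2))%R <= n.+1)%N.
  by move=> /leq_sizeP h; apply/leq_sizeP => j /h; rewrite cX2 => ->; rewrite mulr0.
have cd1 (q : {poly R}) n : (size q <= n.+1)%N -> (q^`())`_n = 0.
  by move=> /leq_sizeP h; rewrite coef_deriv h// mul0rn.
have sd (q : {poly R}) n : (size q <= n.+1)%N -> (size q^`() <= n.+1)%N.
  move=> /leq_sizeP h; apply/leq_sizeP => j nj; rewrite coef_deriv h ?mul0rn//.
  exact: leqW.
(* Powers of $z$ are attached to derivatives so that no factor exceeds the degree of [ta] or [p];
   [coefM_top] then applies to every product. *)
have H' : (ta * p^`()^`() - (ta^`() * p^`()) *+ 2 + ta^`()^`() * p)
    - (ta * ('X^2 * p^`(2)) - ('X * ta^`() * ('X * p^`())) *+ 2 + 'X^2 * ta^`(2) * p)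
    - (2 * alph R k + 1)%:P * (ta * ('X * p^`()))
    + (2 * alph R k - 1)%:P * ('X * ta^`() * p) = (lam R k i)%:P * (ta * p).
  by rewrite [RHS]mulrA -H !derivnS !derivn0; ring.
have := congr1 (fun q : {poly R} => q`_(M + N)) H'.
rewrite !(coefD, coefB, coefCM, coefMn, coefN).
rewrite !coefM_top ?sX1 ?sX2 ?sd//.
rewrite (cd1 p) // (cd1 ta)// (cd1 p^`()) ?sd// (cd1 ta^`()) ?sd// !cX1 !cX2.
rewrite !mulr0 !mul0r ?mul0rn.
move: lN lM; rewrite /lam; move: (p`_N) (ta`_M) => a b a0 b0 E.
have : ((N%:R - M%:R - i%:R) * (N%:R - M%:R + i%:R + 2 * alph R k)) * (a * b) = 0.
  apply/eqP; rewrite -oppr_eq0; apply/eqP; move: E => E.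
  apply: eq_trans (subrr (- (i%:R * (i%:R + 2 * alph R k)) * (b * a))).
  rewrite -{1}E; ring.
move/eqP; rewrite !mulf_eq0 (negbTE a0) (negbTE b0) !orbF alphE2 => /orP[] /eqP E'.
  left; apply/eqP; rewrite -(eqr_nat R) natrD; apply/eqP; lra.
right; apply/eqP; rewrite -(eqr_nat R) !natrD; apply/eqP.
have : (2 * k).+1%:R = (2 * k)%:R + 1 :> R by rewrite -natr1.
lra.
Qed.

End Degrees.

(** * The eigenfamily and its degrees *)

Section Eigenfamily.
Variables (R : realType) (k : nat).

(** The zero polynomial would have norm 0, whereas the norm formula gives a positive value. *)
Lemma pm_neq0 n (m : 'I_n -> nat) (t : 'I_n -> R) i : injective m -> admissible k m t ->
  pm k m t i != 0.
Proof.
move=> mI ad; apply/eqP => p0.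
have := integral_pm_sqr i mI ad; rewrite p0.
under eq_integral do rewrite horner0 expr0n mul0r.
rewrite integral0 => -[] /esym/eqP; rewrite mulf_eq0 invr_eq0 (gt_eqF (nu_gt0 R k i))/=.
apply/negP; rewrite gt_eqF// /delta_t; case: pickP => [j /eqP <-|_]; last by rewrite mul0r addr0.
by rewrite -admissibleE.
Qed.

Lemma hirota_Top (ta p : {poly R}) (l z : R) : ta.[z] != 0 ->
  (1 - 'X ^+ 2) * (ta * p^`(2) - 2 * ta^`() * p^`() + ta^`(2) * p)
    - (2 * alph R k + 1)%:P * 'X * ta * p^`() + (2 * alph R k - 1)%:P * 'X * ta^`() * p
    = l%:P * ta * p -> Top k ta p z = l * p.[z].
Proof.
move=> tz /(congr1 (fun q : {poly R} => q.[z])).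
rewrite !(hornerD, hornerN, hornerM, hornerC, hornerX, hornerXn, hornerMn) /= => H.
apply: (mulfI tz); rewrite /Top; transitivity (l * ta.[z] * p.[z]); last by ring.
by rewrite -H /=; field.
Qed.

Lemma eigenfamily_pm n (m : 'I_n -> nat) (t : 'I_n -> R) : injective m -> admissible k m t ->
  exceptional_eigenfamily k (tau k m t) (pm k m t).
Proof.
move=> mI ad; have t0 := tau_neq0 k m t; have D := darboux_pm k m t.
have p0 i := pm_neq0 i mI ad.
have dg i := hirota_degree t0 (p0 i) (dx_hirota D i).
split=> //; split; last split.
- move=> i; split=> //; exists (lam R k i) => z tz.
  exact: hirota_Top tz (dx_hirota D i).
(* The two alternatives cannot meet: one gives a degree at least $\deg\tau$, the other a smaller
   one. Within each, the degree determines $i$. *)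
- by move=> i j E; have := dg i; have := dg j; rewrite -E => /= -[] h1 [] h2; lia.
(* From this threshold on, the index $d-\deg\tau$ exceeds $\deg\tau$, which excludes the second
   alternative. *)
- exists (2 * (size (tau k m t)).-1 + 1)%N => d hd; exists (d - (size (tau k m t)).-1)%N.
  by have [] := dg (d - (size (tau k m t)).-1)%N; lia.
Qed.

End Eigenfamily.

(** * The linear transformation behind $C_i\mapsto C_{m;i}$ and its inversion *)

Section Span.
Variables (R : realType) (k : nat).
Local Notation C := (gegen R k).
Local Notation W := (Wpoly R k).

Lemma gegen_span n (f : {poly R}) : (size f <= n)%N ->
  exists c : nat -> R, f = \sum_(i < n) (c i)%:P * C i.
Proof.
elim: n f => [|n IH] f sf.
  by exists (fun=> 0); rewrite big_ord0; apply/eqP; rewrite -size_poly_leq0.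
pose a := f`_n / (C n)`_n.
have [|c fE] := IH (f - a%:P * C n).
  apply/leq_sizeP => j; rewrite leq_eqVlt => /predU1P[<-|nj].
    by rewrite coefB coefCM /a mulfVK ?subrr// gegen_lead.
  rewrite coefB coefCM gegen_coef_lt// mulr0 subr0.
  by move/leq_sizeP: sf; apply.
exists (fun i => if i == n then a else c i).
rewrite big_ord_recr /= eqxx -[LHS](subrK (a%:P * C n)) fE; congr (_ + _).
by apply: eq_bigr => i _; rewrite ltn_eqF.
Qed.

Variables (n : nat) (m : 'I_n -> nat) (t : 'I_n -> R).
Local Notation ta := (tau k m t).
Local Notation M := (Rmx k m t).
Local Notation Q := (fun b => (\adj M *m \col_a C (m a)) b ord0).

(** The linear extension of $C_i\mapsto C_{m;i}$: in [pm], $\rho_{i,m_b}$ is the primitive of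
    $C_iC_{m_b}W$, and $C_i$ may be any polynomial [f] there. *)
Definition transf (f : {poly R}) : {poly R} :=
  ta * f - \sum_b (t b)%:P * prim (f * C (m b) * W) * Q b.

Lemma transfD f g : transf (f + g) = transf f + transf g.
Proof.
rewrite /transf mulrDr [RHS]addrACA -opprD -big_split /=; congr (_ - _).
by apply: eq_bigr => b _; rewrite !mulrDl primD; ring.
Qed.

Lemma transfZ a f : transf (a%:P * f) = a%:P * transf f.
Proof.
rewrite /transf mulrBr mulrCA mulr_sumr; congr (_ - _).
apply: eq_bigr => b _.
have -> : a%:P * f * C (m b) * W = a *: (f * C (m b) * W) by rewrite -mul_polyC !mulrA.
by rewrite primZ -mul_polyC; ring.
Qed.

Lemma transf_gegen i : transf (C i) = pm k m t i.
Proof.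
rewrite /transf /pm /bordered rvec_sum; congr (_ - _).
by apply: eq_bigr => b _; rewrite [rvec _ _ _ _ _ _]mxE.
Qed.

Lemma transf_sum (c : nat -> R) N :
  transf (\sum_(i < N) (c i)%:P * C i) = \sum_(i < N) (c i)%:P * pm k m t i.
Proof.
elim: N => [|N IH].
  by rewrite !big_ord0; have := transfZ 0 0; rewrite polyC0 !mul0r.
by rewrite !big_ord_recr /= transfD transfZ transf_gegen IH.
Qed.

Lemma tau_sqr_span (h : {poly R}) :
  exists N (c : nat -> R), ta ^+ 2 * h = \sum_(i < N) (c i)%:P * pm k m t i.
Proof.
pose S b := prim (h * Q b * W).
(* f is the preimage of ta ^+ 2 * h under the transformation. *)
pose f := ta * h + \sum_b (t b)%:P * S b * C (m b).
have [c fE] := gegen_span (leqnn (size f)).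
exists (size f), c; rewrite -transf_sum -fE /transf.
have MQ a : \sum_b M a b * Q b = ta * C (m a) by rewrite mulmx_adj_col mxE.
have ME a b : M a b = (a == b)%:R + (t b)%:P * rho R k (m a) (m b).
  by rewrite mxE mul_polyC.
(* Replacing $\tau C_{m_a}$ by row $a$ of the matrix times [Q] makes the integrand an exact
   derivative, by the product rule for $\rho S$. *)
have P a : prim (f * C (m a) * W) = S a + \sum_b (t b)%:P * rho R k (m b) (m a) * S b.
  apply: primE; last first.
    rewrite hornerD prim_N1 add0r horner_sum big1// => b _.
    by rewrite !hornerM rho_N1 mulr0 mul0r.
  rewrite derivD deriv_prim raddf_sum /= /f.
  rewrite !mulrDl.
  have -> : ta * h * C (m a) * W = h * W * \sum_b M a b * Q b by rewrite MQ; ring.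
  rewrite mulr_suml mulr_suml.
  under eq_bigr do rewrite !derivM derivC deriv_rho deriv_prim.
  have -> : \sum_b M a b * Q b = Q a + \sum_b (t b)%:P * rho R k (m a) (m b) * Q b.
    under eq_bigr do rewrite ME mulrDl.
    rewrite big_split /= (bigD1 a)//= eqxx mul1r big1 ?addr0//.
    by move=> b /negbTE ba; rewrite eq_sym ba mul0r.
  rewrite mulrDr mulr_sumr -addrA -big_split /=; congr (_ + _); first by ring.
  apply: eq_bigr => b _; rewrite rho_sym; ring.
(* By [P] the double sum regroups into rows of the matrix times [Q], and [MQ] collapses it; what
   remains cancels the correction term in [f]. *)
have -> : \sum_b (t b)%:P * prim (f * C (m b) * W) * Q b
    = ta * \sum_b (t b)%:P * S b * C (m b).
  rewrite mulr_sumr.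
  under [RHS]eq_bigr do rewrite mulrCA -MQ mulr_sumr.
  rewrite exchange_big /=; apply: eq_bigr => a _; rewrite P.
  under [RHS]eq_bigr do rewrite ME.
  rewrite mulrDr mulrDl mulr_sumr mulr_suml.
  under [RHS]eq_bigr do rewrite mulrDl mulrDr.
  rewrite big_split /=; congr (_ + _).
    rewrite (bigD1 a)//= eqxx mul1r big1 ?addr0; first by ring.
    by move=> b /negbTE ba; rewrite ba mul0r mulr0.
  by apply: eq_bigr => b _; ring.
rewrite /f; ring.
Qed.

End Span.

(** * Weierstrass approximation by Bernstein polynomials *)

Section Weierstrass.
Variable R : realType.
Implicit Types (phi psi : nat -> R) (u : R).

(* The Bernstein polynomial with nodal values phi 0, ..., phi n, defined by de
   Casteljau's recursion. *)
Fixpoint bernstein n phi : {poly R} :=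
  if n is n'.+1 then (1 - 'X) * bernstein n' phi + 'X * bernstein n' (phi \o S)
  else (phi 0%N)%:P.

Lemma bernsteinS n phi u : (bernstein n.+1 phi).[u] =
  (1 - u) * (bernstein n phi).[u] + u * (bernstein n (phi \o S)).[u].
Proof. by rewrite /= !hornerE. Qed.

Lemma le_bernstein n phi psi u : 0 <= u <= 1 -> (forall j, phi j <= psi j) ->
  (bernstein n phi).[u] <= (bernstein n psi).[u].
Proof.
move=> /andP[u0 u1]; elim: n phi psi => [|n IH] phi psi h; first by rewrite !hornerC.
rewrite !bernsteinS lerD// ler_wpM2l ?subr_ge0//; [exact: IH|].
by apply: IH => j; exact: h.
Qed.

Lemma bernstein_affine n a b phi u :
  (bernstein n (fun j => a + b * phi j)).[u] = a + b * (bernstein n phi).[u].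
Proof.
elim: n phi => [|n IH] phi; first by rewrite !hornerC.
rewrite !bernsteinS IH; have := IH (phi \o S); rewrite /comp => ->; ring.
Qed.

(** The second moment of the binomial law about $c$: squared bias plus variance. The centre is
    general because the recursion shifts $c$ to $c-1$. *)
Lemma bernstein_sqr n c u :
  (bernstein n (fun j => (j%:R - c) ^+ 2)).[u] = (n%:R * u - c) ^+ 2 + n%:R * u * (1 - u).
Proof.
elim: n c => [|n IH] c; first by rewrite hornerC; ring.
rewrite bernsteinS IH.
have -> : (fun j : nat => (j%:R - c) ^+ 2) \o S = (fun j => (j%:R - (c - 1)) ^+ 2).
  by apply/funext => j /=; rewrite -natr1; ring.
by rewrite IH -natr1; ring.
Qed.

(** Only [x] is confined to the segment: [le_bernstein] compares nodal values at all [j], and nodes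
    with $j>n$ lie outside. *)
Lemma uniformly_continuous_segment (phi : R -> R) (eps : R) : continuous phi -> 0 < eps ->
  exists2 d : R, 0 < d & forall x y, -1 <= x <= 1 -> `|x - y| < d -> `|phi x - phi y| < eps.
Proof.
move=> cphi e0.
have /compact_near_coveringP cK := @segment_compact R (-1) 1.
have := cK R (0^'+) (fun d x => forall y, `|x - y| < d -> `|phi x - phi y| < eps) _.
case.
  move=> x _.
  have e20 : 0 < eps / 2 by rewrite divr_gt0.
  have /cvgrPdist_lt/(_ _ e20) := cphi x.
  move=> /nbhs_ballP[r /= r0 xr].
  exists (ball x (r / 2), [set d | d < r / 2]).
    split; first by apply: nbhsx_ballx; rewrite divr_gt0.
    by apply: nbhs_right_lt; rewrite divr_gt0.
  move=> [x' d] /= [xx' dr] y x'y.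
  have h1 := xr x' _; have h2 := xr y _.
  have xx'r : ball x r x' by apply: le_ball xx'; rewrite ler_pdivrMr// ler_pMr// ler1n.
  have xyr : ball x r y.
    move: xx'; rewrite /ball /= => xx'.
    rewrite (le_lt_trans (ler_distD x' _ _))// [ltRHS](splitr r) ltrD//.
    exact: lt_trans x'y dr.
  rewrite (le_lt_trans (ler_distD (phi x) _ _))// [ltRHS](splitr eps) ltrD//.
    by rewrite distrC; exact: h1.
  exact: h2.
move=> d /= d0 h; exists (d / 2); first by rewrite divr_gt0.
move=> x y xI xy.
have := h (d / 2); rewrite /ball /= sub0r normrN gtr0_norm ?divr_gt0// => /(_ _ _) h'.
apply: h' => //=.
by rewrite ltr_pdivrMr// ltr_pMr// ltr1n.
Qed.

(** For fixed $x$, the function lies between the parabolas $\phi(x)\pm(\epsilon/2+K(x-y)^2)$. The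
    Bernstein operator preserves order, and the second moment bounds the quadratic term by $K/n$. *)
Lemma weierstrass (phi : R -> R) (B eps : R) : continuous phi ->
  (forall x, `|phi x| <= B) -> 0 < eps ->
  exists p : {poly R}, forall x : R, -1 <= x <= 1 -> `|phi x - p.[x]| <= eps.
Proof.
move=> cphi bphi e0.
have e20 : 0 < eps / 2 by rewrite divr_gt0.
have [d d0 ucphi] := uniformly_continuous_segment cphi e20.
have B0 : 0 <= B by apply: le_trans (bphi 0).
(* Chosen so that $K(x-y)^2\ge 2B$, the maximal oscillation, as soon as $|x-y|\ge d$. *)
pose K := 2 * B / d ^+ 2.
have K0 : 0 <= K by rewrite divr_ge0 ?sqr_ge0// mulr_ge0.
have mod x y : -1 <= x <= 1 -> `|phi x - phi y| <= eps / 2 + K * (x - y) ^+ 2.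
  move=> xI; have [xy|xy] := ltP `|x - y| d.
    by apply: le_trans (ltW (ucphi x y xI xy)) _; rewrite lerDl mulr_ge0 ?sqr_ge0.
  apply: (@le_trans _ _ (2 * B)).
    apply: le_trans (ler_normB _ _) _.
    by rewrite [2 * B]mulr_natl mulr2n lerD.
  apply: (@le_trans _ _ (K * (x - y) ^+ 2)); last by rewrite lerDr ltW.
  rewrite /K mulrAC ler_pdivlMr ?exprn_gt0// ler_wpM2l ?mulr_ge0//.
  by rewrite -[leRHS]real_normK ?num_real// ler_sqr ?nnegrE// ltW.
have [n n0 nK] : exists2 n : nat, (n%:R : R) != 0 & K / n%:R <= eps / 2.
  exists (Num.truncn (2 * K / eps)).+1; first by rewrite pnatr_eq0.
  have := truncnS_gt (2 * K / eps).
  rewrite ltr_pdivrMr// ler_pdivrMr ?ltr0n// => H; lra.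
have Kn0 : 0 <= K / n%:R := divr_ge0 K0 (ler0n _ _).
pose node j : R := 2 * j%:R / n%:R - 1.
exists (bernstein n (phi \o node) \Po (2^-1 *: (1 + 'X))) => x xI.
rewrite horner_comp hornerZ hornerD hornerX -polyC1 hornerC; set u := 2^-1 * (1 + x).
have uI : 0 <= u <= 1 by move/andP: xI => [x1 x2]; apply/andP; rewrite /u; split; lra.
have xu : x = 2 * u - 1 by rewrite /u; field.
have sq j : (x - node j) ^+ 2 = 4 / n%:R ^+ 2 * (j%:R - n%:R * u) ^+ 2.
  by rewrite /node xu; field.
pose q j : R := (j%:R - n%:R * u) ^+ 2.
have Eq : (bernstein n q).[u] = n%:R * u * (1 - u).
  by rewrite /q bernstein_sqr subrr expr0n add0r.
have small : K * (4 / n%:R ^+ 2) * (n%:R * u * (1 - u)) <= K / n%:R.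
  have -> : K * (4 / n%:R ^+ 2) * (n%:R * u * (1 - u)) = K / n%:R * (4 * (u * (1 - u))) by field.
  rewrite ler_piMr//.
  have : 0 <= (2 * u - 1) ^+ 2 by exact: sqr_ge0.
  by rewrite !expr2; nra.
have bd j : phi x - (eps / 2 + K * (4 / n%:R ^+ 2) * q j) <= (phi \o node) j
     <= phi x + (eps / 2 + K * (4 / n%:R ^+ 2) * q j).
  have := mod x (node j) xI; rewrite sq mulrA -/(q j) distrC ler_distl.
  by rewrite /comp.
have lo := @le_bernstein n (fun j => (phi x - eps / 2) + (- (K * (4 / n%:R ^+ 2))) * q j) (phi \o node) u uI.
have hi := @le_bernstein n (phi \o node) (fun j => (phi x + eps / 2) + (K * (4 / n%:R ^+ 2)) * q j) u uI.
rewrite !bernstein_affine !Eq in lo hi.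
rewrite distrC ler_distl; apply/andP; split.
  apply: le_trans (lo _); last by move=> j; have /andP[+ _] := bd j; apply: le_trans; lra.
  lra.
apply: le_trans (hi _) _; last by lra.
by move=> j; have /andP[_] := bd j => h; apply: le_trans h _; lra.
Qed.

End Weierstrass.

(** * Density of polynomials in a weighted $L^2$ space *)

Section Density.
Variable R : realType.
Notation mu := (@lebesgue_measure R).
Local Notation I := (`[(-1)%R, 1%R]%classic : set R).

Definition clamp (B x : R) : R := Num.max (- B) (Num.min x B).

Variant clamp_spec (B x : R) : R -> Prop :=
| ClampId of - B <= x <= B : clamp_spec B x x
| ClampHi of B < x : clamp_spec B x B
| ClampLo of x < - B : clamp_spec B x (- B).

Lemma clampP B x : 0 <= B -> clamp_spec B x (clamp B x).
Proof.
move=> B0; rewrite /clamp; have [xB|xB] := leP x B.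
  have [h|h] := leP (- B) x; last exact: ClampLo.
  by apply: ClampId; rewrite h.
rewrite max_r; last by lra.
exact: ClampHi.
Qed.

Lemma clamp_bound B x : 0 <= B -> `|clamp B x| <= B.
Proof. by move=> B0; rewrite ler_norml; case: clampP => // *; lra. Qed.

Lemma clamp_id B x : `|x| <= B -> clamp B x = x.
Proof. by rewrite ler_norml /clamp => /andP[h1 h2]; rewrite min_l// max_r. Qed.

Lemma clamp_lip B x y : 0 <= B -> `|clamp B x - clamp B y| <= `|x - y|.
Proof.
move=> B0; have h1 := ler_norm (x - y); have h2 := ler_norm (y - x).
rewrite distrC in h2; rewrite ler_norml.
by case: (clampP x B0) => [/andP[]|?|?]; case: (clampP y B0) => [/andP[]|?|?]; move=> *; lra.
Qed.

Lemma clamp_le B x : 0 <= B -> `|x - clamp B x| <= `|x|.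
Proof.
move=> B0; have h1 := ler_norm x; have h2 := ler_norm (- x).
rewrite normrN in h2; rewrite ler_norml.
by case: (clampP x B0) => [/andP[]|?|?]; move=> *; lra.
Qed.

Lemma measurable_clamp B (g : R -> R) : measurable_fun I g ->
  measurable_fun I (fun x => clamp B (g x)).
Proof.
move=> mg; apply: (@measurable_maxr _ _ _ _ (fun=> - B)); first exact: measurable_cst.
by apply: measurable_minr => //; exact: measurable_cst.
Qed.

Lemma continuous_clamp B (g : R -> R) : 0 <= B -> continuous g ->
  continuous (fun x => clamp B (g x)).
Proof.
move=> B0 cg x; apply/cvgrPdist_lt => e e0.
have /cvgrPdist_lt/(_ _ e0) := cg x.
by apply: filterS => y; apply: le_lt_trans; exact: clamp_lip.
Qed.

Let mI : measurable I. Proof. exact: measurable_itv. Qed.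

Lemma integral_lt_sum3 (f a b : R -> R) (c ea eb : R) :
  measurable_fun I f -> measurable_fun I a -> measurable_fun I b ->
  (forall x, I x -> 0 <= f x <= a x + b x + c) ->
  (forall x, I x -> 0 <= a x) -> (forall x, I x -> 0 <= b x) -> 0 <= c ->
  (\int[mu]_(x in I) (a x)%:E < ea%:E)%E -> (\int[mu]_(x in I) (b x)%:E <= eb%:E)%E ->
  (\int[mu]_(x in I) (f x)%:E < (ea + eb + 2 * c)%:E)%E.
Proof.
move=> mf ma mb fle a0 b0 c0 ia ib.
have iC : (\int[mu]_(x in I) c%:E = (2 * c)%:E)%E.
  have muI : mu I = (2 : R)%:E.
    by rewrite lebesgue_measure_itv /= lte_fin ifT; [rewrite -EFinB; congr EFin; ring|lra].
  transitivity (c%:E * mu I)%E; first exact: integral_cst.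
  by rewrite muI -EFinM mulrC.
apply: (@le_lt_trans _ _ (\int[mu]_(x in I) ((a x)%:E + (b x)%:E + c%:E))%E).
  apply: ge0_le_integral => //.
  - by move=> x /fle /andP[]; rewrite lee_fin.
  - exact/measurable_EFinP.
  - apply: emeasurable_funD; last exact: measurable_cst.
    by apply: emeasurable_funD; exact/measurable_EFinP.
  - by move=> x /fle /andP[_]; rewrite -!EFinD lee_fin.
rewrite ge0_integralD//=; last first.
  by apply: emeasurable_funD; exact/measurable_EFinP.
  by move=> x Ix; rewrite -EFinD lee_fin addr_ge0 ?a0 ?b0.
rewrite ge0_integralD//=; try exact/measurable_EFinP.
rewrite iC; move: ia ib.
case: (\int[mu]_(x in _) (a x)%:E)%E => [x||]; case: (\int[mu]_(x in _) (b x)%:E)%E => [y||] //=;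
  rewrite -?EFinD ?lte_fin ?lee_fin ?addNye ?addeNy ?ltNyr// => *; lra.
Qed.

Lemma cvg0_lt (u : nat -> \bar R) (e : R) : u @ \oo --> 0%E -> 0 < e ->
  exists N, (u N < e%:E)%E.
Proof.
move=> cu e0.
have : \forall n \near \oo, (u n < e%:E)%E.
  have /(_ [set y | (y < e%:E)%E]) := cu; apply; exists e => //= r; rewrite /ball /= sub0r normrN lte_fin.
  by apply: le_lt_trans; exact: ler_norm.
by move=> [N _ h]; exists N; apply: h => /=.
Qed.

(** Dominated convergence: the integrands are dominated by $g^2v$ and are eventually 0 at each
    point. *)
Lemma truncation_L2 (g v : R -> R) (e : R) :
  measurable_fun I g -> measurable_fun I v -> (forall x, I x -> 0 <= v x) ->
  (\int[mu]_(x in I) (g x ^+ 2 * v x)%:E < +oo)%E -> 0 < e ->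
  exists N : nat, (\int[mu]_(x in I) ((g x - clamp N%:R (g x)) ^+ 2 * v x)%:E < e%:E)%E.
Proof.
move=> mg mv v0 ig e0.
pose F n x : \bar R := ((g x - clamp n%:R (g x)) ^+ 2 * v x)%:E.
have mF n : measurable_fun I (F n).
  apply/measurable_EFinP/measurable_funM => //; apply: measurable_funX.
  by apply: measurable_funB => //; exact: measurable_clamp.
have mG : measurable_fun I (fun x => (g x ^+ 2 * v x)%:E).
  by apply/measurable_EFinP/measurable_funM => //; exact: measurable_funX.
have iG : integrable mu I (fun x => (g x ^+ 2 * v x)%:E).
  apply/integrableP; split => //.
  under eq_integral => x /set_mem Ix.
    rewrite gee0_abs; last by rewrite lee_fin mulr_ge0 ?sqr_ge0 ?v0.
    over.
  exact: ig.
have FG : {ae mu, forall x n, I x -> (`|F n x| <= (g x ^+ 2 * v x)%:E)%E}.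
  apply: aeW => x n Ix; rewrite /F gee0_abs; last first.
    by rewrite lee_fin mulr_ge0 ?sqr_ge0 ?v0.
  rewrite lee_fin ler_wpM2r ?v0// -[leLHS]real_normK ?num_real// -[leRHS]real_normK ?num_real//.
  by rewrite lerXn2r ?nnegrE// clamp_le.
have F0 : {ae mu, forall x, I x -> F ^~ x @ \oo --> 0%E}.
  apply: aeW => x Ix; apply: cvg_near_cst; near=> n.
  rewrite /F clamp_id ?subrr ?expr0n ?mul0r//.
  apply: ltW; apply: lt_le_trans (truncnS_gt _) _; rewrite ler_nat.
  by near: n; exact: nbhs_infty_ge.
have [_ _] := @dominated_convergence _ _ _ mu I mI F (fun=> 0%E)
  (fun x => (g x ^+ 2 * v x)%:E) mF (measurable_cst _) F0 iG FG.
by rewrite integral0 => cF; apply: cvg0_lt.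
Unshelve. all: by end_near. Qed.

(** The weight may vanish, so $g$ itself need not be integrable and is truncated first. The bounded
    part is approximated in $L^1$ by a continuous function, which is clamped and then approximated
    uniformly by a polynomial. *)
Lemma poly_dense_L2 (g v : R -> R) (eps : R) :
  measurable_fun I g -> continuous v -> (forall x, I x -> 0 <= v x) ->
  (\int[mu]_(x in I) (g x ^+ 2 * v x)%:E < +oo)%E -> 0 < eps ->
  exists p : {poly R}, (\int[mu]_(x in I) ((g x - p.[x]) ^+ 2 * v x)%:E < eps%:E)%E.
Proof.
move=> mg cv v0 ig e0.
have mv : measurable_fun I v by apply: measurable_funTS; exact: continuous_measurable_fun.
have [c cI vc] := @EVT_max R v (-1) 1 (ltac:(lra)) (continuous_subspaceT cv).
pose V := v c + 1.
have V0 : 0 < V by rewrite /V ltr_wpDl ?v0.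
have vV x : I x -> v x <= V by move=> /vc h; apply: le_trans h _; rewrite lerDl.
have e12 : 0 < eps / 12 by rewrite divr_gt0.
have [N iN] := truncation_L2 mg mv v0 ig e12.
pose B : R := N%:R; have B0 : 0 <= B by exact: ler0n.
pose gB x := clamp B (g x).
have mgB : measurable_fun I gB by exact: measurable_clamp.
have muI : (mu I < +oo)%E.
  by rewrite lebesgue_measure_itv /= lte_fin ifT; [rewrite -EFinB ltry|lra].
have igB : integrable mu I (EFin \o gB).
  apply: measurable_bounded_integrable => //.
  exists B; split; first exact: num_real.
  by move=> M BM x Ix; apply: le_trans (ltW BM); exact: clamp_bound.
have [phi_ [cphi _ phi0]] := approximation_continuous_integrable (measurable_itv _) muI igB.
(* By $(a+b+e)^2\le 3(a^2+b^2+e^2)$ and $b^2\le 2B|b|$, the $L^1$ error is multiplied by at most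
   $6BV$; the summand 1 keeps the denominator positive when $B=0$. *)
pose d := eps / (24 * (B * V + 1)).
have BV0 : 0 <= B * V by rewrite mulr_ge0// ltW.
have d0 : 0 < d by rewrite divr_gt0// mulr_gt0//; lra.
have [n phin] := cvg0_lt phi0 d0.
(* Clamping supplies the bound $2B$ on the difference to [gB], and does not increase that difference
   since [gB] is already clamped. *)
pose phi x := clamp B (phi_ n x).
(* With $\eta\le 1$ one has $\eta^2\le\eta$, so no square root is needed. *)
pose eta := Num.min 1 (eps / (24 * V)).
have eta0 : 0 < eta by rewrite /eta lt_min ltr01 divr_gt0// mulr_gt0.
have etaV : eta ^+ 2 * V <= eps / 24.
  apply: (@le_trans _ _ (eta * V)).
    rewrite ler_wpM2r ?(ltW V0)// expr2 ler_piMl ?(ltW eta0)//.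
    by rewrite /eta ge_min lexx.
  apply: (@le_trans _ _ (eps / (24 * V) * V)).
    by rewrite ler_wpM2r ?(ltW V0)// /eta ge_min lexx orbT.
  by rewrite le_eqVlt; apply/orP; left; apply/eqP; field; rewrite gt_eqF.
have [p pphi] := weierstrass (continuous_clamp B0 (cphi n)) (fun x => clamp_bound _ B0) eta0.
exists p.
have Ba x : I x -> 0 <= 3 * ((g x - gB x) ^+ 2 * v x).
  by move=> Ix; rewrite mulr_ge0// mulr_ge0 ?sqr_ge0 ?v0.
have Bb x : I x -> 0 <= 6 * (B * V) * `|gB x - phi_ n x|.
  by move=> Ix; rewrite mulr_ge0// mulr_ge0.
have mphi : measurable_fun I (phi_ n).
  by apply: measurable_funTS; exact: continuous_measurable_fun.
have mp : measurable_fun I (fun x => p.[x]).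
  by apply: measurable_funTS; apply: continuous_measurable_fun; exact: continuous_horner.
have -> : eps = eps / 4 + eps / 4 + 2 * (eps / 4) :> R by field.
apply: (@integral_lt_sum3 _ (fun x => 3 * ((g x - gB x) ^+ 2 * v x))
   (fun x => 6 * (B * V) * `|gB x - phi_ n x|)) => //.
- by apply: measurable_funM => //; apply: measurable_funX; exact: measurable_funB.
- apply: measurable_funM; first exact: measurable_cst.
  by apply: measurable_funM => //; apply: measurable_funX; exact: measurable_funB.
- apply: measurable_funM; first exact: measurable_cst.
  by apply: measurableT_comp => //; exact: measurable_funB.
- move=> x Ix; rewrite mulr_ge0 ?sqr_ge0 ?v0//=.
  have xI : -1 <= x <= 1 by move: Ix; rewrite /= in_itv.
  set a := g x - gB x; set b := gB x - phi x; set e := phi x - p.[x].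
  have -> : g x - p.[x] = a + b + e by rewrite /a /b /e; ring.
  have sq3 : (a + b + e) ^+ 2 <= 3 * (a ^+ 2 + b ^+ 2 + e ^+ 2).
    have := sqr_ge0 (a - b); have := sqr_ge0 (b - e); have := sqr_ge0 (a - e).
    by rewrite !expr2; nra.
  have bb : b ^+ 2 <= 2 * B * `|gB x - phi_ n x|.
    rewrite -[b ^+ 2]real_normK ?num_real// expr2; apply: ler_pM => //.
      apply: le_trans (ler_normB _ _) _.
      by rewrite [2 * B]mulr_natl mulr2n lerD// clamp_bound.
    have -> : b = clamp B (gB x) - clamp B (phi_ n x).
      by rewrite [clamp B (gB x)]clamp_id// clamp_bound.
    exact: clamp_lip.
  have ee : e ^+ 2 <= eta ^+ 2.
    rewrite -[e ^+ 2]real_normK ?num_real// lerXn2r ?nnegrE ?(ltW eta0)//.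
    exact: pphi.
  have vx0 := v0 x Ix; have vxV := vV x Ix.
  apply: (@le_trans _ _ (3 * (a ^+ 2 + b ^+ 2 + e ^+ 2) * v x)); first by rewrite ler_wpM2r.
  have h1 : b ^+ 2 * v x <= 2 * B * `|gB x - phi_ n x| * V by apply: ler_pM => //; exact: sqr_ge0.
  have h2 : e ^+ 2 * v x <= eta ^+ 2 * V by apply: ler_pM => //; exact: sqr_ge0.
  lra.
- by rewrite divr_ge0// ltW.
- under eq_integral do rewrite EFinM.
  rewrite ge0_integralZl//; last 2 first.
  + apply/measurable_EFinP; apply: measurable_funM => //; apply: measurable_funX.
    exact: measurable_funB.
  + by move=> x Ix; rewrite lee_fin mulr_ge0 ?sqr_ge0 ?v0.
  have -> : (eps / 4)%:E = (3%:E * (eps / 12)%:E)%E :> \bar R by rewrite -EFinM; congr EFin; field.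
  by rewrite lte_pmul2l.
- under eq_integral do rewrite EFinM.
  rewrite ge0_integralZl//; last 2 first.
  + apply/measurable_EFinP; apply: measurableT_comp => //; exact: measurable_funB.
  + by rewrite lee_fin mulr_ge0.
  apply: (@le_trans _ _ ((6 * (B * V))%:E * d%:E)%E).
    apply: lee_wpmul2l; first by rewrite lee_fin mulr_ge0.
    exact: ltW.
  have dE : d * (24 * (B * V + 1)) = eps by rewrite /d mulfVK// gt_eqF//; lra.
  have -> : eps / 4 = 6 * (B * V) * d + 6 * d by rewrite -dE; field.
  by rewrite -EFinM lee_fin lerDl mulr_ge0// ltW.
Qed.

End Density.

(** * Completeness of the exceptional family *)

Section Completeness.
Variables (R : realType) (k : nat).

(** Approximating $f$ by $\tau^2p$ with weight $W/\tau^2$ is the same as approximating $f/\tau^2$ by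
    $p$ with the polynomial weight $\tau^2W$. *)
Lemma complete_pm n (m : 'I_n -> nat) (t : 'I_n -> R) : nonvanishing (tau k m t) ->
  complete_L2 (Wtau k (tau k m t)) (pm k m t).
Proof.
move=> h f mf fL2 eps e0.
set ta := tau k m t in h *.
pose V := ta ^+ 2 * Wpoly R k.
have Vx (x : R) : V.[x] = ta.[x] ^+ 2 * (1 - x ^+ 2) ^+ k.
  by rewrite /V hornerM horner_exp /Wpoly horner_exp !hornerE.
have I11E (x : R) : I11 (R:=R) x -> -1 <= x <= 1 by rewrite /I11 /= in_itv.
pose g x := f x * (ta.[x])^-1 ^+ 2.
have mg : measurable_fun (I11 (R:=R)) g.
  apply: measurable_funM => //; apply: measurable_funX.
  apply: subspace_continuous_measurable_fun; first exact: measurable_itv.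
  apply: continuous_in_subspaceT => x; rewrite inE => /I11E xI.
  by apply: cvgV; [exact: h|exact: continuous_horner].
have [|||p hp] := @poly_dense_L2 R g (fun x => V.[x]) eps mg _ _ _ e0.
- exact: continuous_horner.
- move=> x /I11E xI; rewrite /V hornerM mulr_ge0 ?Wpoly_ge0//.
  by rewrite horner_exp sqr_ge0.
- suff -> : (\int[@lebesgue_measure R]_(x in `[(-1)%R, 1%R]) (g x ^+ 2 * V.[x])%:E =
    \int[@lebesgue_measure R]_(x in I11 (R:=R)) (f x ^+ 2 * Wtau k ta x)%:E)%E by [].
  apply: eq_integral => x /set_mem/I11E/h tx; congr EFin; rewrite Vx /g /Wtau.
  by field.
have [N [c Ec]] := tau_sqr_span k m t p.
exists N, c.
suff -> : (\int[@lebesgue_measure R]_(x in I11 (R:=R))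
     ((f x - \sum_(i < N) c i * (pm k m t i).[x]) ^+ 2 * Wtau k ta x)%:E =
    \int[@lebesgue_measure R]_(x in `[(-1)%R, 1%R]) ((g x - p.[x]) ^+ 2 * V.[x])%:E)%E by [].
apply: eq_integral => x /set_mem/I11E/h tx; congr EFin.
have -> : \sum_(i < N) c i * (pm k m t i).[x] = ta.[x] ^+ 2 * p.[x].
  rewrite -horner_exp -hornerM Ec horner_sum.
  by apply: eq_bigr => i _; rewrite hornerM hornerC.
by rewrite Vx /g /Wtau; field.
Qed.

End Completeness.

Theorem mainTheorem17 (R : realType) (k n : nat) (m : 'I_n -> nat) (t : 'I_n -> R) :
  injective m ->
  ((forall z : R, -1 <= z <= 1 -> (tau k m t).[z] != 0) <->
     (forall j : 'I_n, - (nu R k (m j))^-1 < t j)) /\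
  ((forall j : 'I_n, - (nu R k (m j))^-1 < t j) ->
     forall s : R,
       XGegenbauer_family k (tau k m t) (Cmi k m t s) /\
       (forall i : nat,
          (\int[@lebesgue_measure R]_(u in `[(-1)%R, 1%R])
              (((Cmi k m t s i).[u]) ^+ 2 * Wtau k (tau k m t) u)%:E)%E
          = (nu R k i / (1 + delta_t m t i * nu R k i))%:E)).
Proof.
move=> mI; split.
  by split; [exact: nonvanishing_admissible|exact: admissible_nonvanishing].
move=> ad s; have h := admissible_nonvanishing mI ad.
have -> : Cmi k m t s = pm k m t by apply/funext => i; exact: Cmi_pm.
split; last by move=> i; exact: integral_pm_sqr.
by split=> //; split; [exact: eigenfamily_pm|exact: complete_pm].
Qed.
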